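(* Let $\mathcal{H}$ be a set of two connected graphs with $\mathcal{H}\in\{\{K_{1,3},Z_4\},\{K_{1,3},B_{1,2}\},\{K_{1,3},N_{1,1,1}\},\{P_4,W\},\{K_{1,3}^{**},Z_1\}\}$. Then every $2$-connected $\mathcal{H}$-free graph has a dominating cycle.
   Context: All graphs are finite and simple. A cycle $C$ in a graph $G$ is dominating if every edge of $G$ has at least one end vertex on $C$. $G$ is $\mathcal{H}$-free if it contains no member of $\mathcal{H}$ as an induced subgraph. $P_n$ is the path of order $n$, $K_{1,3}$ the claw. $Z_n$ is obtained from a triangle by attaching a path with $n$ new vertices at one triangle vertex. $B_{m,n}$ is obtained from a triangle $abc$ by attaching a path of $m$ new vertices at $a$ and a path of $n$ new vertices at $b$. $N_{l,m,n}$ is obtained from a triangle $abc$ by attaching paths of $l,m,n$ new vertices at $a,b,c$ respectively. $W=K_1+3K_2$ (one vertex joined to all vertices of three disjoint edges). $K_{1,3}^{*}$ is $K_{1,3}$ with each edge subdivided once, and $K_{1,3}^{**}$ is obtained from $K_{1,3}^{*}$ by deleting one vertex of degree $1$. *)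

(* Defs.v *)
From Stdlib Require List.
From mathcomp Require Import all_boot.
Set Implicit Arguments.
Unset Strict Implicit.
Unset Printing Implicit Defensive.

Record sgraph := SGraph {
  vertex :> finType;
  adj : rel vertex;
  adj_sym : symmetric adj;
  adj_irrefl : irreflexive adj
}.

Section Induced.
Variables (G : sgraph) (S : {set G}).

Definition induced_adj : rel {x : G | x \in S} :=
  fun x y => adj (val x) (val y).

Lemma induced_adj_sym : symmetric induced_adj.
Proof. by move=> x y; apply: adj_sym. Qed.

Lemma induced_adj_irrefl : irreflexive induced_adj.
Proof. by move=> x; apply: adj_irrefl. Qed.

Definition induced : sgraph := SGraph induced_adj_sym induced_adj_irrefl.
End Induced.

Definition isomorphic (G H : sgraph) : Prop :=
  exists2 f : G -> H, bijective f & forall x y, adj (f x) (f y) = adj x y.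

Definition contains_induced (G H : sgraph) : Prop :=
  exists S : {set G}, isomorphic H (induced S).

Definition free (Hs : seq sgraph) (G : sgraph) : Prop :=
  forall H, List.In H Hs -> ~ contains_induced G H.

Definition delete (G : sgraph) (X : {set G}) : sgraph := induced (~: X).

Definition connected (G : sgraph) : Prop :=
  0 < #|G| /\ forall x y : G, connect (@adj G) x y.

Definition k_connected (k : nat) (G : sgraph) : Prop :=
  k < #|G| /\ forall X : {set G}, #|X| < k -> connected (delete X).

(* The bound on the size excludes the degenerate [ucycle]s formed by the empty
   sequence and by a single edge traversed back and forth. *)
Definition is_cycle (G : sgraph) (C : seq G) : Prop :=
  2 < size C /\ ucycle (@adj G) C.

Definition dominating (G : sgraph) (C : seq G) : Prop :=
  forall x y : G, adj x y -> x \in C \/ y \in C.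

Definition has_dominating_cycle (G : sgraph) : Prop :=
  exists C : seq G, is_cycle C /\ dominating C.

Section Complete.
Variable n : nat.

Definition complete_adj : rel 'I_n := fun i j => i != j.

Lemma complete_adj_sym : symmetric complete_adj.
Proof. by move=> i j; rewrite /complete_adj eq_sym. Qed.

Lemma complete_adj_irrefl : irreflexive complete_adj.
Proof. by move=> i; rewrite /complete_adj eqxx. Qed.

Definition complete : sgraph := SGraph complete_adj_sym complete_adj_irrefl.
End Complete.

Section PathGraph.
Variable n : nat.

Definition path_adj : rel 'I_n :=
  fun i j => (i.+1 == j :> nat) || (j.+1 == i :> nat).

Lemma path_adj_sym : symmetric path_adj.
Proof. by move=> i j; rewrite /path_adj orbC. Qed.

Lemma path_adj_irrefl : irreflexive path_adj.
Proof. by move=> i; rewrite /path_adj orbb gtn_eqF. Qed.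

(* [n] counts vertices, not edges. *)
Definition path_graph : sgraph := SGraph path_adj_sym path_adj_irrefl.
End PathGraph.

Section CompleteBipartite.
Variables m n : nat.

Definition bipartite_adj : rel ('I_m + 'I_n) :=
  fun u v => match u, v with
             | inl _, inr _ | inr _, inl _ => true
             | _, _ => false
             end.

Lemma bipartite_adj_sym : symmetric bipartite_adj.
Proof. by case=> i [] j. Qed.

Lemma bipartite_adj_irrefl : irreflexive bipartite_adj.
Proof. by case. Qed.

Definition complete_bipartite : sgraph :=
  SGraph bipartite_adj_sym bipartite_adj_irrefl.
End CompleteBipartite.

Section Join.
Variables G H : sgraph.

Definition join_adj : rel (G + H) :=
  fun u v => match u, v with
             | inl x, inl y => adj x y
             | inr x, inr y => adj x y
             | _, _ => true
             end.

Lemma join_adj_sym : symmetric join_adj.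
Proof. by case=> x [] y //=; apply: adj_sym. Qed.

Lemma join_adj_irrefl : irreflexive join_adj.
Proof. by case=> x /=; apply: adj_irrefl. Qed.

Definition join : sgraph := SGraph join_adj_sym join_adj_irrefl.
End Join.

Section Copies.
Variables (k : nat) (G : sgraph).

Definition copies_adj : rel ('I_k * G) :=
  fun u v => (u.1 == v.1) && adj u.2 v.2.

Lemma copies_adj_sym : symmetric copies_adj.
Proof. by move=> u v; rewrite /copies_adj eq_sym adj_sym. Qed.

Lemma copies_adj_irrefl : irreflexive copies_adj.
Proof. by move=> u; rewrite /copies_adj adj_irrefl andbF. Qed.

Definition copies : sgraph := SGraph copies_adj_sym copies_adj_irrefl.
End Copies.

Section AttachPath.
Variables (G : sgraph) (v : G) (n : nat).

Definition attach_adj : rel (G + 'I_n) :=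
  fun s t => match s, t with
             | inl x, inl y => adj x y
             | inl x, inr i | inr i, inl x => (x == v) && (i == 0 :> nat)
             | inr i, inr j => path_adj i j
             end.

Lemma attach_adj_sym : symmetric attach_adj.
Proof.
by case=> x [] y //=; [apply: adj_sym | apply: path_adj_sym].
Qed.

Lemma attach_adj_irrefl : irreflexive attach_adj.
Proof. by case=> x /=; [apply: adj_irrefl | apply: path_adj_irrefl]. Qed.

(* [G] together with a path on [n] new vertices, the first of which is joined
   to [v]. *)
Definition attach_path : sgraph := SGraph attach_adj_sym attach_adj_irrefl.
End AttachPath.

Section Subdivision.
Variable G : sgraph.

Definition is_edge (e : {set G}) : bool :=
  [exists x, exists y, adj x y && (e == [set x; y])].

Definition subdivide_adj : rel (G + {e : {set G} | is_edge e}) :=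
  fun s t => match s, t with
             | inl x, inr e | inr e, inl x => x \in val e
             | _, _ => false
             end.

Lemma subdivide_adj_sym : symmetric subdivide_adj.
Proof. by case=> x []. Qed.

Lemma subdivide_adj_irrefl : irreflexive subdivide_adj.
Proof. by case. Qed.

(* [inr e] is the vertex placed in the middle of the edge [e]. *)
Definition subdivide : sgraph :=
  SGraph subdivide_adj_sym subdivide_adj_irrefl.
End Subdivision.

Definition triangle : sgraph := complete 3.
Definition tri_a : triangle := @Ordinal 3 0 isT.
Definition tri_b : triangle := @Ordinal 3 1 isT.
Definition tri_c : triangle := @Ordinal 3 2 isT.

Definition graph_Z (n : nat) : sgraph := attach_path tri_a n.

Definition graph_B (m n : nat) : sgraph :=
  @attach_path (attach_path tri_a m) (inl tri_b) n.

Definition graph_N (l m n : nat) : sgraph :=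
  @attach_path (graph_B l m) (inl (inl tri_c)) n.

Definition claw : sgraph := complete_bipartite 1 3.

Definition graph_W : sgraph := join (complete 1) (copies 3 (complete 2)).

Definition claw_star : sgraph := subdivide claw.

(* The end vertices of [claw_star] are the [inl (inr i)]; by symmetry any of
   them may be deleted. *)
Definition claw_star_end : claw_star := inl (inr ord0).

Definition claw_star_star : sgraph := delete [set claw_star_end].

Definition forbidden_pairs : seq (seq sgraph) :=
  [:: [:: claw; graph_Z 4];
      [:: claw; graph_B 1 2];
      [:: claw; graph_N 1 1 1];
      [:: path_graph 4; graph_W];
      [:: claw_star_star; graph_Z 1]].

(* Main.v *)
(* Let [C] be a longest cycle and suppose that some component [H] of [G - C] has
   an edge.  By 2-connectedness [H] has at least two attachments on [C]; whenever
   two of them are the ends of a path inside [C] that misses fewer vertices than a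
   detour through [H] provides, [C] was not longest.

   [P_4, W]: an attachment is complete to [H], and an arc between consecutive
   attachments produces [W] or [P_4].

   [K_{1,3}^{**}, Z_1]: with a triangle the graph is complete multipartite and
   every vertex of [C] is an attachment.  Without triangles, excluding
   [K_{1,3}^{**}] makes consecutive distance levels from an attachment completely
   joined, and this chain of complete bipartite graphs has a path with prescribed
   ends that misses at most one vertex.

   [K_{1,3}, N_{1,1,1}] and [K_{1,3}, B_{1,2}]: the distance levels of [C] from an
   attachment [u] are cliques (two nonadjacent vertices of a level have distinct
   parents, which span a net with a common parent), and alternating between the
   two sides of [u] level by level yields the spanning path.

   [K_{1,3}, Z_4]: if the neighbourhoods in [H] of two attachments are disjoint, a
   shortest path between them is the tail of [Z_4].  Otherwise some attachment [u]
   lies in a triangle with two vertices of [H], so no induced path with four edges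
   leaves [u] inside [C], and every other attachment is reached within four steps. *)

Require Import Defs.
From Stdlib Require List.
From mathcomp Require Import all_boot zify.
Set Implicit Arguments.
Unset Strict Implicit.
Unset Printing Implicit Defensive.

(** * Walks and cycles *)

Definition walk (G : sgraph) (x : G) (s : seq G) (y : G) : bool :=
  if s is z :: s' then [&& z == x, path (@adj G) x s' & last x s' == y]
  else false.

Arguments walk : simpl never.

Section Walks.
Variable G : sgraph.
Implicit Types (x y z : G) (s t : seq G).

Lemma adjC x y : adj x y = adj y x.
Proof. exact: adj_sym. Qed.

Lemma adjxx x : adj x x = false.
Proof. exact: adj_irrefl. Qed.

Lemma adj_neq x y : adj x y -> x != y.
Proof. by move=> xy; apply: contraTneq xy => ->; rewrite adjxx. Qed.

Lemma walk1 x : walk x [:: x] x.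
Proof. by rewrite /walk /= !eqxx. Qed.

Lemma walkE x s y : walk x s y ->
  exists2 s', s = x :: s' & path (@adj G) x s' /\ last x s' = y.
Proof.
by case: s => // z s /and3P[/eqP-> p /eqP l]; exists s.
Qed.

Lemma walk_cons x y z s : adj x y -> walk y s z -> walk x (x :: s) z.
Proof.
move=> xy /walkE[s' -> [p l]].
by rewrite /walk /= eqxx xy p l eqxx.
Qed.

Lemma walk_cat x s y z t w :
  walk x s y -> adj y z -> walk z t w -> walk x (s ++ t) w.
Proof.
move=> /walkE[s' -> [p l]] yz /walkE[t' -> [p' l']].
by rewrite /walk /= eqxx cat_path last_cat p l /= yz p' l' eqxx.
Qed.

Lemma walk_rcons x s y z : walk x s y -> adj y z -> walk x (rcons s z) z.
Proof. by rewrite -cats1 => xs yz; apply: walk_cat xs yz (walk1 z). Qed.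

Lemma walk_rev x s y : walk x s y -> walk y (rev s) x.
Proof.
elim: s x => // z s IH x /walkE[s' [ez es] [p l]].
rewrite {z}ez; case: s es IH => [|x1 s] es IH.
  by move: l; rewrite -es /= => <-; exact: walk1.
move: p l; rewrite -{s'}es /= => /andP[xx' p] l.
rewrite rev_cons; apply: (@walk_rcons _ _ x1); last by rewrite adjC.
by apply: IH; rewrite /walk eqxx p l eqxx.
Qed.

Lemma walk_consI x z s y : walk x (z :: s) y ->
  z = x /\ ((s = [::] /\ y = x) \/ exists2 x', adj x x' & walk x' s y).
Proof.
move=> /walkE[s' [-> ->] [p l]]; split=> //.
case: s' p l => [_ /= ->|x' s' /= /andP[xx' p] l]; first by left.
by right; exists x' => //; rewrite /walk eqxx p l eqxx.
Qed.

Lemma walk_catI x s t y : walk x (s ++ t) y -> s != [::] -> t != [::] ->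
  exists c d, [/\ walk x s c, adj c d & walk d t y].
Proof.
elim: s x => // z s IH x /= /walk_consI[-> [[e _]|[x' xx' w]]] _ t0.
  by case: s e {IH} => //= e; rewrite e in t0.
case: s IH w => [_|z' s IH] w.
  by exists x, x'; split=> //; exact: walk1.
have [c [d [w1 cd w2]]] := IH _ w isT t0.
by exists c, d; split=> //; apply: walk_cons w1.
Qed.

Lemma walk_rconsI x s z y : walk x (rcons s z) y ->
  z = y /\ ((s = [::] /\ y = x) \/ exists2 y', adj y' y & walk x s y').
Proof.
rewrite -cats1 => w; case: s w => [|z' s] w.
  by move: w => /walk_consI[-> [[_ ->]|[? _ //]]]; split=> //; left.
have [c [d [w1 cd /walk_consI[-> [[_ ->]|[//]]]]]] := walk_catI w isT isT.
by split=> //; right; exists c.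
Qed.

Lemma walk_splitI x s z t y : walk x (s ++ z :: t) y ->
  walk x (rcons s z) z /\ walk z (z :: t) y.
Proof.
elim: s x => [|z' s IH] x w.
  by have [e _] := walk_consI w; rewrite e in w *; split=> //; exact: walk1.
have [-> [[e _]|[x' xx' /IH[w1 w2]]]] := walk_consI w; first by case: s e {IH w}.
by split=> //; apply: walk_cons w1.
Qed.

Lemma walk_head_eq x s y x' s' y' t :
  walk x s y -> walk x' s' y' -> s' = s ++ t -> x = x'.
Proof. by move=> /walkE[s1 -> _] /walkE[s2 -> _] []. Qed.

Lemma walk_mem_head x s y : walk x s y -> x \in s.
Proof. by move=> /walkE[s' -> _]; rewrite mem_head. Qed.

Lemma walk_mem_last x s y : walk x s y -> y \in s.
Proof. by move=> /walkE[s' -> [_ <-]]; rewrite mem_last. Qed.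

Lemma walk_cycle x s y : walk x s y -> adj y x -> cycle (@adj G) s.
Proof.
by move=> /walkE[s' -> [p l]] yx; rewrite /= rcons_path p l.
Qed.

Lemma cycle_walk x s : cycle (@adj G) (x :: s) ->
  exists2 y, walk x (x :: s) y & adj y x.
Proof.
rewrite /= rcons_path => /andP[p a]; exists (last x s) => //.
by rewrite /walk !eqxx p.
Qed.

Lemma walk_first (P : pred G) x s y : walk x s y -> P x -> ~~ all P s ->
  exists s1 s2 z z', [/\ s = s1 ++ s2, walk x s1 z, adj z z', walk z' s2 y &
    [/\ all P s1, P z & ~~ P z']].
Proof.
elim: s x => // t s IH x /walk_consI[-> [[-> ->]|[x' xx' w]]] Px /=; rewrite Px //.
move=> /= Ps; have [Px'|Px'] := boolP (P x'); last first.
  by exists [:: x], s, x, x'; rewrite walk1 /= Px.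
have [s1 [s2 [z [z' [-> w1 zz' w2 [a1 Pz Pz']]]]]] := IH _ w Px' Ps.
exists (x :: s1), s2, z, z'; rewrite /= Px; split=> //.
exact: walk_cons w1.
Qed.

Lemma walk_cross (P : pred G) x s y : walk x s y -> P x -> ~~ P y ->
  exists s1 s2 z z', [/\ s = s1 ++ s2, walk x s1 z, adj z z', walk z' s2 y &
    [/\ all P s1, P z & ~~ P z']].
Proof.
move=> w Px Py; apply: (walk_first w Px).
by apply/allPn; exists y => //; exact: walk_mem_last w.
Qed.

End Walks.

Ltac count_tac :=
  rewrite -?cats1 ?rev_cat; apply/permP=> ?;
  do 4 rewrite ?count_cat ?count_rev /=; clear; lia.

Ltac perm_tac Hp := apply: perm_trans Hp; count_tac.

Section Setting.
Variables (G : sgraph) (C : seq G) (H : {set G}).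
Implicit Types (u v w x y z h : G) (A B q : seq G).

(* [C] is a longest cycle and [H] a component with an edge of the rest of the
   graph; the last clause comes from 2-connectedness. *)
Definition outer_component : Prop :=
  [/\ @is_cycle G C, (forall C', @is_cycle G C' -> size C' <= size C),
    [/\ (forall h, h \in H -> h \notin C),
    (forall h z, h \in H -> adj h z -> z \notin C -> z \in H) &
    (forall h h', h \in H -> h' \in H -> exists p,
       [/\ walk h p h', uniq p & {subset p <= H}])],
    (exists h h', [/\ h \in H, h' \in H & adj h h']) &
    (forall z, exists w h,
       [/\ w \in C, h \in H, adj w h, w != z & h != z])].

Definition attached u : bool := (u \in C) && [exists h in H, adj u h].

Local Notation att := attached.

Lemma attP u : reflect (u \in C /\ exists2 h, h \in H & adj u h) (att u).
Proof.
apply: (iffP andP) => [[uC /exists_inP[h hH uh]]|[uC [h hH uh]]].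
  by split=> //; exists h.
by split=> //; apply/exists_inP; exists h.
Qed.

Definition linked u w p : Prop := exists h h' hs,
  [/\ size hs = p, adj u h, adj h' w, walk h hs h' & uniq hs /\ {subset hs <= H}].

Hypothesis hS : outer_component.

Lemma uniqC : uniq C.
Proof. by case: hS => [[_ /andP[]]]. Qed.

Lemma sizeC : 2 < size C.
Proof. by case: hS => [[]]. Qed.

Lemma notinC h : h \in H -> h \notin C.
Proof. by case: hS => _ _ [+ _ _] _ _; apply. Qed.

Lemma linked_sym u w p : linked u w p -> linked w u p.
Proof.
case=> h [h' [hs [sz uh hw wk [un sub]]]]; exists h', h, (rev hs).
rewrite size_rev rev_uniq (adjC w) hw (adjC h) uh; split=> //.
  exact: walk_rev.
by split=> // x; rewrite mem_rev; apply: sub.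
Qed.

(* Closing [q] up through [H] yields a cycle that loses the vertices of [r] and
   gains [p] new ones. *)
Lemma reroute u w p q r : linked u w p -> u != w -> walk u q w ->
  perm_eq (q ++ r) C -> size r < p -> False.
Proof.
case=> h [h' [hs [sz uh hw wk [un sub]]]] uw wq pq szr.
have uqr : uniq (q ++ r) by rewrite (perm_uniq pq) uniqC.
have [_ mx _ _ _] := hS.
have sq : 1 < size q.
  move: wq => /walkE[[|? ?] -> [_ /= e]] //.
  by rewrite e eqxx in uw.
have : size (q ++ rev hs) <= size C.
  apply: mx; split.
    rewrite size_cat size_rev sz; lia.
  apply/andP; split.
    apply: (@walk_cycle _ u _ h); last by rewrite adjC.
    by apply: walk_cat wq _ (walk_rev wk); rewrite adjC.
  rewrite cat_uniq rev_uniq un; move: uqr; rewrite cat_uniq => /and3P[-> _ _] /=.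
  rewrite andbT; apply/hasPn=> x; rewrite mem_rev => /sub xH.
  apply: contra (notinC xH) => xq.
  by rewrite -(perm_mem pq) mem_cat xq.
  by rewrite size_cat size_rev sz -(perm_size pq) size_cat leq_add2l leqNgt szr.
Qed.

Lemma linkedS u w h h' : h \in H -> h' \in H -> adj u h -> adj w h' ->
  exists2 p, 0 < p & linked u w p.
Proof.
move=> hH h'H uh wh; have [_ _ [_ _ cn] _ _] := hS.
have [p [wk un sub]] := cn _ _ hH h'H.
exists (size p); first by case: p wk {un sub}.
by exists h, h', p; rewrite uh (adjC h') wh.
Qed.

Lemma linkedSS u w h h' : h \in H -> h' \in H -> h != h' -> adj u h ->
  adj w h' -> exists2 p, 1 < p & linked u w p.
Proof.
move=> hH h'H hh' uh wh; have [_ _ [_ _ cn] _ _] := hS.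
have [p [wk un sub]] := cn _ _ hH h'H.
exists (size p); last by exists h, h', p; rewrite uh (adjC h') wh.
case: p wk {un sub} => // x [|//] /walk_consI[_ [[_ e]|[//]]].
by rewrite e eqxx in hh'.
Qed.

Lemma linked_edge u w h h' : h \in H -> h' \in H -> adj h h' -> adj u h ->
  adj w h' -> linked u w 2.
Proof.
move=> hH h'H hh' uh wh; exists h, h', [:: h; h'].
rewrite uh (adjC h') wh; split=> //; first by apply: walk_cons hh' (walk1 _).
split; first by rewrite /= inE (adj_neq hh').
by move=> x; rewrite !inE => /orP[] /eqP->.
Qed.

Lemma att_linked u w : att u -> att w -> exists2 p, 0 < p & linked u w p.
Proof.
move=> /attP[_ [h hH uh]] /attP[_ [h' h'H uh']]; exact: linkedS uh uh'.
Qed.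

Lemma reroute_all u w q : att u -> att w -> u != w -> walk u q w ->
  perm_eq q C -> False.
Proof.
move=> au aw uw wq pq; have [p p0 l] := att_linked au aw.
by apply: (reroute l uw wq (r := [::])); rewrite ?cats0.
Qed.

Lemma attC u : att u -> u \in C.
Proof. by case/andP. Qed.

(* The vertices of [C] in the cyclic order [u, A, w, B], where [A] runs from [b]
   to [c] and [B] from [d] to [a]. *)
Definition arr u A w B b c d a : Prop :=
  [/\ walk b A c, walk d B a, [/\ adj u b, adj c w, adj w d & adj a u] &
      perm_eq (u :: A ++ w :: B) C].

Lemma arr_rev u A w B b c d a : arr u A w B b c d a ->
  arr u (rev B) w (rev A) a d c b.
Proof.
case=> wA wB [ub cw wd au] p; split; try exact: walk_rev.
  by rewrite (adjC u a) (adjC d w) (adjC w c) (adjC b u).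
by perm_tac p.
Qed.

Lemma arr_swap u A w B b c d a : arr u A w B b c d a -> arr w B u A d a b c.
Proof. by case=> wA wB [ub cw wd au] p; split=> //; perm_tac p. Qed.

Lemma arr_mem u A w B b c d a x : arr u A w B b c d a ->
  (x \in C) = (x \in u :: A ++ w :: B).
Proof. by case=> _ _ _ p; rewrite (perm_mem p). Qed.

Lemma arr_uniq u A w B b c d a : arr u A w B b c d a ->
  uniq (u :: A ++ w :: B).
Proof. by case=> _ _ _ p; rewrite (perm_uniq p) uniqC. Qed.

Lemma arr_neq u A w B b c d a : arr u A w B b c d a -> u != w.
Proof.
move/arr_uniq=> /= /andP[+ _]; apply: contraNneq => ->.
by rewrite mem_cat mem_head orbT.
Qed.

Lemma arr_intro u A w B : att u -> att w -> cycle (@adj G) (u :: A ++ w :: B) ->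
  perm_eq (u :: A ++ w :: B) C -> exists b c d a, arr u A w B b c d a.
Proof.
move=> au aw cy p.
have uw : u != w.
  have : uniq (u :: A ++ w :: B) by rewrite (perm_uniq p) uniqC.
  by move=> /= /andP[+ _]; apply: contraNneq => ->; rewrite mem_cat mem_head orbT.
have [a wk au'] := cycle_walk cy.
have A0 : A != [::].
  apply: contraTneq isT => A0; move: p wk; rewrite A0 /= => p wk.
  have [_ [[//]|[x ux wB]]] := walk_consI wk.
  have [e _] := walk_consI wB; rewrite -{x}e in ux wB.
  case: (@reroute_all w u (rcons (w :: B) u)) => //; first by rewrite eq_sym.
    exact: walk_rcons wB au'.
  by perm_tac p.
have B0 : B != [::].
  apply: contraTneq isT => B0; move: p wk; rewrite B0 -cat_cons cats1 => p wk.
  have [e _] := walk_rconsI wk; rewrite -e in wk.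
  by case: (@reroute_all u w (rcons (u :: A) w)).
have [_ [[e _]|[b ub wk']]] := walk_consI wk; first by case: A A0 e {p wk cy}.
have [c [w' [wA cw wk'']]] := walk_catI wk' A0 isT.
have [e [[//]|[d wd wB]]] := walk_consI wk''; first by move=> e'; rewrite e' in B0.
by exists b, c, d, a; split=> //; split=> //; rewrite e.
Qed.

End Setting.

(** * Forbidden induced subgraphs *)

Lemma contains_embedding (G K : sgraph) (f : K -> G) : injective f ->
  (forall x y, adj (f x) (f y) = adj x y) -> contains_induced G K.
Proof.
move=> fi fa; exists [set f x | x in [set: K]].
have fP x : f x \in [set f x | x in [set: K]] by apply: imset_f; rewrite inE.
exists (fun x => exist _ (f x) (fP x)); last by move=> x y; exact: fa.
apply: inj_card_bij => [x y [/fi]//|].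
by rewrite card_sig card_imset // cardsT.
Qed.

Lemma free_embedding (Hs : seq sgraph) (G K : sgraph) : free Hs G ->
  List.In K Hs -> forall f : K -> G, injective f ->
  (forall x y, adj (f x) (f y) = adj x y) -> False.
Proof.
by move=> fr inK f fi fa; apply: (fr _ inK); apply: contains_embedding fa.
Qed.

Ltac ord_case i :=
  let m := fresh "m" in let lt := fresh "lt" in
  destruct i as [m lt]; do 5 (try (destruct m as [|m])); try discriminate lt.

Ltac sum_case x :=
  lazymatch type of x with
  | ordinal _ => ord_case x
  | _ => let T := type of x in let T' := eval hnf in T in
     lazymatch T' with
     | sum _ _ => let y := fresh "y" in destruct x as [y|y]; sum_case y
     | prod _ _ => let y := fresh "y" in let z := fresh "z" in
         destruct x as [y z]; sum_case y; sum_case z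
     | ordinal _ => change T' in x; ord_case x
     end
  end.

Ltac both_sides :=
  repeat match goal with
  | H : is_true (adj ?x ?y) |- _ =>
      pose proof (etrans (adjC y x) H); change (adj x y = true) in H
  | H : is_true (~~ adj ?x ?y) |- _ =>
      apply negbTE in H; pose proof (etrans (adjC y x) H)
  end.

Ltac distinct_by E :=
  match type of E with ?x = ?y =>
    match goal with
    | H : x <> y |- _ => by case: (H E)
    | H : y <> x |- _ => by case: (H (esym E))
    | H : adj x y = true |- _ => by rewrite E adjxx in H
    | H1 : adj x ?z = true, H2 : adj y ?z = false |- _ => by rewrite E H2 in H1
    | H1 : adj x ?z = false, H2 : adj y ?z = true |- _ => by rewrite E H2 in H1
    end
  end.

Ltac distinct := let E := fresh in move=> E; exfalso; distinct_by E.

Ltac diag := first [ by apply: val_inj | f_equal; diag ].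

Ltac inj_goal :=
  let x := fresh "x" in let y := fresh "y" in
  move=> x y; sum_case x; sum_case y; cbn;
  lazymatch goal with
  | |- ?z = ?z -> _ => move=> _; diag
  | _ => let E := fresh in move=> E; exfalso; distinct_by E
  end.

Ltac adj_goal :=
  let x := fresh "x" in let y := fresh "y" in
  move=> x y; sum_case x; sum_case y;
  match goal with
  | |- adj ?u ?v = _ => let u' := eval cbn in u in let v' := eval cbn in v in
     first [ change (adj u' v' = true); assumption
           | change (adj u' v' = false); (assumption || exact: adjxx) ]
  end.

Section Patterns.
Variables (Hs : seq sgraph) (G : sgraph).
Hypothesis hfree : free Hs G.
Implicit Types (a b c h p q u v w x y z : G).

Lemma claw_free u x y z : List.In claw Hs ->
  adj u x -> adj u y -> adj u z -> x != y -> x != z -> y != z ->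
  ~~ adj x y -> ~~ adj x z -> ~~ adj y z -> False.
Proof.
move=> inH ux uy uz /eqP xy /eqP xz /eqP yz nxy nxz nyz; both_sides.
apply: (@free_embedding _ _ _ hfree inH
  (fun s => match s with inl _ => u | inr i => nth u [:: x; y; z] i end)).
  by inj_goal.
by adj_goal.
Qed.

Lemma Z4_free a b c p1 p2 p3 p4 : List.In (graph_Z 4) Hs ->
  adj a b -> adj a c -> adj b c -> adj a p1 -> adj p1 p2 -> adj p2 p3 ->
  adj p3 p4 ->
  ~~ adj a p2 -> ~~ adj a p3 -> ~~ adj a p4 ->
  ~~ adj b p1 -> ~~ adj b p2 -> ~~ adj b p3 -> ~~ adj b p4 ->
  ~~ adj c p1 -> ~~ adj c p2 -> ~~ adj c p3 -> ~~ adj c p4 ->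
  ~~ adj p1 p3 -> ~~ adj p1 p4 -> ~~ adj p2 p4 -> False.
Proof.
move=> inH *; both_sides.
apply: (@free_embedding _ _ _ hfree inH
  (fun s => match s with inl i => nth a [:: a; b; c] i
                       | inr i => nth a [:: p1; p2; p3; p4] i end)).
  by inj_goal.
by adj_goal.
Qed.

Lemma B12_free a b c p q1 q2 : List.In (graph_B 1 2) Hs ->
  adj a b -> adj a c -> adj b c -> adj b p -> adj a q1 -> adj q1 q2 ->
  ~~ adj a p -> ~~ adj a q2 -> ~~ adj b q1 -> ~~ adj b q2 ->
  ~~ adj c p -> ~~ adj c q1 -> ~~ adj c q2 -> ~~ adj p q1 -> ~~ adj p q2 ->
  False.
Proof.
move=> inH *; both_sides.
apply: (@free_embedding _ _ _ hfree inH
  (fun s => match s with inl (inl i) => nth a [:: b; a; c] i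
     | inl (inr i) => p | inr i => nth a [:: q1; q2] i end)).
  by inj_goal.
by adj_goal.
Qed.

Lemma net_free a b c p q r : List.In (graph_N 1 1 1) Hs ->
  adj a b -> adj a c -> adj b c -> adj a p -> adj b q -> adj c r ->
  ~~ adj a q -> ~~ adj a r -> ~~ adj b p -> ~~ adj b r -> ~~ adj c p ->
  ~~ adj c q -> ~~ adj p q -> ~~ adj p r -> ~~ adj q r -> False.
Proof.
move=> inH *; both_sides.
apply: (@free_embedding _ _ _ hfree inH
  (fun s => match s with inl (inl (inl i)) => nth a [:: a; b; c] i
     | inl (inl (inr _)) => p | inl (inr _) => q | inr _ => r end)).
  by inj_goal.
by adj_goal.
Qed.

Lemma P4_free a b c d : List.In (path_graph 4) Hs ->
  adj a b -> adj b c -> adj c d -> ~~ adj a c -> ~~ adj a d -> ~~ adj b d ->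
  False.
Proof.
move=> inH *; both_sides.
apply: (@free_embedding _ _ _ hfree inH (fun i => nth a [:: a; b; c; d] i)).
  by inj_goal.
by adj_goal.
Qed.

Lemma W_free u x1 x2 y1 y2 z1 z2 : List.In graph_W Hs ->
  adj u x1 -> adj u x2 -> adj u y1 -> adj u y2 -> adj u z1 -> adj u z2 ->
  adj x1 x2 -> adj y1 y2 -> adj z1 z2 ->
  ~~ adj x1 y1 -> ~~ adj x1 y2 -> ~~ adj x2 y1 -> ~~ adj x2 y2 ->
  ~~ adj x1 z1 -> ~~ adj x1 z2 -> ~~ adj x2 z1 -> ~~ adj x2 z2 ->
  ~~ adj y1 z1 -> ~~ adj y1 z2 -> ~~ adj y2 z1 -> ~~ adj y2 z2 -> False.
Proof.
move=> inH *; both_sides.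
apply: (@free_embedding _ _ _ hfree inH
  (fun s => match s with inl _ => u
     | inr (i, j) => nth u (nth [::] [:: [:: x1; x2]; [:: y1; y2]; [:: z1; z2]] i) j
     end)).
  by inj_goal.
by adj_goal.
Qed.

Lemma Z1_free a b c p : List.In (graph_Z 1) Hs ->
  adj a b -> adj a c -> adj b c -> adj a p -> ~~ adj b p -> ~~ adj c p -> False.
Proof.
move=> inH *; both_sides.
apply: (@free_embedding _ _ _ hfree inH
  (fun s => match s with inl i => nth a [:: a; b; c] i | inr i => p end)).
  by inj_goal.
by adj_goal.
Qed.

Lemma claw_edge (e : {set claw}) : is_edge e ->
  exists i : 'I_3, e = [set inl ord0; inr i].
Proof.
case/existsP=> x /existsP[y /andP[xy /eqP->]]; case: x y xy => x [] y //= _.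
  by exists y; rewrite (ord1 x).
by exists x; rewrite (ord1 y) setUC.
Qed.

Definition spider_map v l p1 p2 q1 q2 (s : claw_star) : G :=
  match s with
  | inl (inl _) => v
  | inl (inr i) => nth v [:: v; p2; q2] i
  | inr e => if inr ord0 \in val e then l
             else if inr (@Ordinal 3 1 isT) \in val e then p1 else q1
  end.

Lemma spider_free v l p1 p2 q1 q2 : List.In claw_star_star Hs ->
  adj v l -> adj v p1 -> adj v q1 -> adj p1 p2 -> adj q1 q2 ->
  ~~ adj v p2 -> ~~ adj v q2 -> ~~ adj l p1 -> ~~ adj l p2 -> ~~ adj l q1 ->
  ~~ adj l q2 -> ~~ adj p1 q1 -> ~~ adj p1 q2 -> ~~ adj p2 q1 -> ~~ adj p2 q2 ->
  False.
Proof.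
move=> inH *; both_sides.
have mem0 (e : {e : {set claw} | is_edge e}) (x : 'I_1) : inl x \in val e.
  by case: e => e /= /claw_edge[i ->]; rewrite (ord1 x) !inE eqxx.
have cases (e : {e : {set claw} | is_edge e}) :
    exists i : 'I_3, val e = [set inl ord0; inr i].
  by case: e => e /= /claw_edge.
apply: (@free_embedding _ _ _ hfree inH
  (fun s : claw_star_star => spider_map v l p1 p2 q1 q2 (val s))).
  move=> [s hs] [t ht] /= E; apply: val_inj => /=; move: hs ht E.
  rewrite !inE; case: s => [[x|x]|e]; case: t => [[y|y]|e'] => hs ht /=.
  - by rewrite (ord1 x) (ord1 y).
  - by move: ht; ord_case y => //= _; distinct.
  - by case: (cases e') => i ->; ord_case i; rewrite !inE /=; distinct.
  - by move: hs; ord_case x => //= _; distinct.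
  - move: hs ht; ord_case x; ord_case y => //= _ _; try distinct;
    by move=> _; congr (inl (inr _)); apply: val_inj.
  - by case: (cases e') => i ->; move: hs; ord_case x => //= _; ord_case i;
    rewrite !inE /=; distinct.
  - by case: (cases e) => i ->; ord_case i; rewrite !inE /=; distinct.
  - by case: (cases e) => i ->; move: ht; ord_case y => //= _; ord_case i;
    rewrite !inE /=; distinct.
  - case: (cases e) (cases e') => i ei [j ej] E; congr inr; apply: val_inj.
    apply: (etrans ei (etrans _ (esym ej))); move: E; rewrite ei ej.
    ord_case i; ord_case j; rewrite !inE /=; try distinct;
    by move=> _; congr ([set _; inr _]); apply: val_inj.
move=> [s hs] [t ht]; rewrite [RHS](_ : _ = subdivide_adj s t) //=; move: hs ht.
rewrite !inE; case: s => [[x|x]|e]; case: t => [[y|y]|e'] => hs ht /=.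
- exact: adjxx.
- by move: ht; ord_case y => //=.
- by rewrite mem0; case: (cases e') => i ->; ord_case i; rewrite !inE /=.
- by move: hs; ord_case x => //=.
- by move: hs ht; ord_case x; ord_case y => //= _ _; rewrite ?adjxx.
- by case: (cases e') => i ->; move: hs; ord_case x => //= _; ord_case i;
  rewrite !inE /=.
- by rewrite mem0; case: (cases e) => i ->; ord_case i; rewrite !inE /=.
- by case: (cases e) => i ->; move: ht; ord_case y => //= _; ord_case i;
  rewrite !inE /=.
- by case: (cases e) (cases e') => i -> [j ->]; ord_case i; ord_case j;
  rewrite !inE /= ?adjxx.
Qed.

End Patterns.

(** * Longest cycles in 2-connected graphs *)

Section Existence.
Variable G : sgraph.
Implicit Types (x y z : G) (C : seq G).

Lemma connect_cross (T : finType) (e : rel T) (P : pred T) (x y : T) :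
  connect e x y -> P x -> ~~ P y -> exists a b, [/\ e a b, P a & ~~ P b].
Proof.
case/connectP=> p; elim: p x => /= [x _ -> -> //|x' p IH x /andP[xx' pp] l Px Py].
by have [Px'|nPx'] := boolP (P x'); [exact: IH pp l Px' Py|exists x, x'].
Qed.

Hypothesis conn : k_connected 2 G.

Lemma delete1_connect z x y (xz : x \in ~: [set z]) (yz : y \in ~: [set z]) :
  connect (@adj (delete [set z])) (exist _ x xz) (exist _ y yz).
Proof. by have [_ /(_ [set z])] := conn; rewrite cards1 => /(_ isT) [_]; apply. Qed.

Lemma delete1_cross z (P : pred G) x y : x != z -> y != z -> P x -> ~~ P y ->
  exists a b, [/\ adj a b, P a, ~~ P b, a != z & b != z].
Proof.
move=> xz yz Px Py.
have xz' : x \in ~: [set z] by rewrite !inE.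
have yz' : y \in ~: [set z] by rewrite !inE.
have := @connect_cross _ _ (fun v => P (val v)) _ _ (delete1_connect xz' yz') Px Py.
case=> [[a az]] [[b bz]] [ab Pa Pb]; exists a, b.
have := az; have := bz; rewrite !inE => bz' az'; by split.
Qed.

Lemma three_vertices : exists x y z : G, [/\ x != y, x != z & y != z].
Proof.
have [cG _] := conn; move: cG (enum_uniq G); rewrite cardE.
case: (enum G) => [|x [|y [|z s]]] //= _; rewrite !inE !negb_or.
by case/and3P=> /and3P[xy xz _] /andP[yz _] _; exists x, y, z.
Qed.

Lemma cycle_exists : exists C, @is_cycle G C.
Proof.
have [x [y [z [xy xz yz]]]] := three_vertices.
have [x1 [b [xb /eqP x1x bx _ bz]]] :=
  @delete1_cross z (pred1 x) x y xz yz (eqxx x) ltac:(by rewrite /= eq_sym).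
move: xb bx; rewrite {x1}x1x /= => xb bx.
have [y' [y'x y'b]] : exists y', y' != x /\ y' != b.
  by have [yb|yb] := eqVneq y b;
    [exists z; rewrite eq_sym xz eq_sym bz | exists y; rewrite eq_sym xy yb].
have [x2 [b' [xb' /eqP x2x b'x _ b'b]]] :=
  @delete1_cross b (pred1 x) x y' ltac:(by rewrite eq_sym) y'b (eqxx x) y'x.
move: xb' b'x; rewrite {x2}x2x /= => xb' b'x.
have bX : b \in ~: [set x] by rewrite !inE.
have b'X : b' \in ~: [set x] by rewrite !inE.
case/connectP: (delete1_connect bX b'X) => p0 /shortenP[p pp up _] e {p0}.
set b0 : delete [set x] := exist _ b bX in pp up e.
set q : seq G := map val (b0 :: p).
have wq : walk b q b'.
  rewrite /q /walk /= eqxx (last_map val p b0) -e eqxx andbT.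
  exact: (@homo_path _ _ val _ _ b0 p _ pp).
exists (x :: q); split.
  rewrite /= /q; case: p pp up e {q wq} => //= _ _ [] bb.
  by rewrite bb eqxx in b'b.
apply/andP; split.
  by apply: (@walk_cycle _ x _ b'); [exact: walk_cons xb wq|rewrite adjC].
rewrite cons_uniq; apply/andP; split.
  by apply/mapP=> [[[v vX] _ /= xv]]; move: vX; rewrite -xv !inE eqxx.
by rewrite map_inj_uniq //; exact: val_inj.
Qed.

Lemma longest_cycle_exists : exists2 C, @is_cycle G C &
  forall C', @is_cycle G C' -> size C' <= size C.
Proof.
pose P n := [exists t : n.-tuple G, (2 < n) && ucycleb (@adj G) t].
have PP C : is_cycle C -> P (size C).
  by case=> sC uC; apply/existsP; exists (in_tuple C); rewrite sC.
have exP : exists n, P n.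
  by have [C /PP PC] := cycle_exists; exists (size C).
have bP n : P n -> n <= #|G|.
  case/existsP=> t /and3P[_ _ ut].
  by rewrite -(size_tuple t) -(card_uniqP ut) max_card.
case: (ex_maxnP exP bP) => n /existsP[t /andP[n2 ut]] mx; exists (tval t).
  by split; rewrite ?size_tuple.
by move=> C' /PP /mx; rewrite size_tuple.
Qed.

Lemma dominating_or_outer_component : has_dominating_cycle G \/
  exists C (H : {set G}), outer_component C H.
Proof.
have [C Ccyc Cmax] := longest_cycle_exists.
have [D|] := boolP [forall x, forall y, adj x y ==> (x \in C) || (y \in C)].
  left; exists C; split=> // x y xy.
  by apply/orP; move/forallP/(_ x)/forallP/(_ y)/implyP: D; apply.
case/forallPn=> x /forallPn[y]; rewrite negb_imply negb_or => /and3P[xy xC yC].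
right.
pose e0 : rel G := fun a b => [&& adj a b, a \notin C & b \notin C].
have e0s : symmetric e0 by move=> a b; rewrite /e0 adjC [X in _ && X]andbC.
exists C, [set z | connect e0 x z].
have dis h : h \in [set z | connect e0 x z] -> h \notin C.
  rewrite inE => cn; apply/negP=> hC.
  have [||a [b [/and3P[_ _ bC] _ /negP[]]]] :=
    @connect_cross _ _ (fun z => z \notin C) _ _ cn; rewrite ?negbK //.
have clo h z : h \in [set z | connect e0 x z] -> adj h z -> z \notin C ->
    z \in [set z | connect e0 x z].
  move=> hH hz zC; move: (hH); rewrite !inE => cn; apply: connect_trans cn _.
  by apply: connect1; rewrite /e0 hz zC dis.
have xH : x \in [set z | connect e0 x z] by rewrite inE connect0.
have yH := clo _ _ xH xy yC.
split=> //; [split=> // | by exists x, y |].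
  move=> h h'; rewrite !inE => c1 c2.
  have : connect e0 h h' by apply: connect_trans c2; rewrite (sym_connect_sym e0s).
  case/connectP=> p0 /shortenP[p pp up _] e {p0}.
  exists (h :: p); split=> //.
    by rewrite /walk eqxx -e eqxx andbT /=; apply: sub_path pp => a b /and3P[].
  by move=> v vp; rewrite inE; apply: connect_trans c1 (path_connect pp vp).
move=> z.
have [h hz hH] : exists2 h, h != z & h \in [set z | connect e0 x z].
  have [xz|xz] := eqVneq x z; last by exists x.
  by exists y; rewrite // -xz eq_sym (adj_neq xy).
have [c cz cC] : exists2 c, c != z & c \in C.
  case: Ccyc; case: (C) => [|c1 [|c2 s]] // _ /andP[_ /=].
  rewrite inE negb_or => /andP[/andP[c12 _] _].
  have [c1z|c1z] := eqVneq c1 z; last by exists c1; rewrite ?mem_head.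
  by exists c2; rewrite -?c1z 1?eq_sym // !inE eqxx orbT.
have cH : c \notin [set z | connect e0 x z].
  by apply/negP=> /dis; rewrite cC.
have [a [b [ab aH bH az bz]]] := delete1_cross hz cz hH cH.
exists b, a; rewrite adjC; split=> //.
by apply: contraNT bH; exact: clo aH ab.
Qed.

End Existence.

(** * Distance levels *)

Section Levels.
Variables (G : sgraph) (X : pred G) (r : G).
Implicit Types (x y z : G).

Definition ball n : {set G} :=
  iter n (fun S => S :|: [set y | X y & [exists x in S, adj x y]]) [set r].

(* Distance from [r] through [X]; it is [#|G|] at the vertices not reached. *)
Definition level y := find (fun n => y \in ball n) (iota 0 #|G|).

Lemma ball_step n x y : x \in ball n -> adj x y -> X y -> y \in ball n.+1.
Proof.
move=> xb xy Xy; rewrite /= !inE Xy /=; apply/orP; right.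
by apply/exists_inP; exists x.
Qed.

Lemma ball_leq m n : m <= n -> ball m \subset ball n.
Proof.
move/subnK=> <-; elim: (n - m) => [|k IH]; first by rewrite add0n.
by apply: subset_trans IH _; rewrite addSn /= subsetUl.
Qed.

Lemma ball_new n y : y \in ball n.+1 -> y \notin ball n ->
  X y /\ exists x, [/\ x \in ball n, adj x y &
    forall m, m < n -> x \notin ball m].
Proof.
rewrite /= !inE => /orP[->//|/andP[Xy /exists_inP[x xb xy]] yb].
split=> //; exists x; split=> // m mn; apply: contra yb => xm.
exact: (subsetP (ball_leq mn) _ (ball_step xm xy Xy)).
Qed.

Lemma ball_card n y : y \in ball n -> (forall m, m < n -> y \notin ball m) ->
  n < #|ball n|.
Proof.
elim: n y => [|n IH] y yb ym; first by rewrite cards1.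
have [_ [x [xb _ xm]]] := ball_new yb (ym n (ltnSn n)).
apply: leq_ltn_trans (IH _ xb xm) _; apply: proper_card; apply/properP.
by split; [exact: ball_leq | exists y => //; exact: ym].
Qed.

Lemma level_ball n y : y \in ball n -> level y <= n /\ level y < #|G|.
Proof.
elim: n => [|n IH] yb.
  have G0 : 0 < #|G| by apply/card_gt0P; exists y.
  by rewrite /level; case: #|G| G0 => //= N _; rewrite yb.
have [/IH[ln lG]|yn] := boolP (y \in ball n); first by split=> //; exact: leqW.
have ym m : m < n.+1 -> y \notin ball m.
  by move=> mn; apply: contra yn; exact: (subsetP (@ball_leq m n mn)).
have nG : n.+1 < #|G| by apply: leq_trans (ball_card yb ym) (max_card _).
have le : level y <= n.+1.
  rewrite leqNgt; apply/negP=> lt.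
  by have := before_find 0 lt; rewrite nth_iota // add0n yb.
by split=> //; apply: leq_ltn_trans le nG.
Qed.

Lemma level_mem y : level y < #|G| -> y \in ball (level y).
Proof.
move=> lt; have : has (fun n => y \in ball n) (iota 0 #|G|).
  by rewrite has_find size_iota.
by move=> /(nth_find 0); rewrite nth_iota.
Qed.

Lemma level_root : level r = 0.
Proof.
have r0 : r \in ball 0 by rewrite inE.
by have [] := level_ball r0; case: (level r).
Qed.

Lemma level_eq0 y : level y = 0 -> y = r.
Proof.
have [lt e|] := ltnP (level y) #|G|.
  by have := level_mem lt; rewrite e inE => /eqP.
move=> Gl e; move: Gl; rewrite e leqn0 => /eqP G0.
by have := max_card (pred1 y); rewrite card1 G0.
Qed.

Lemma level_step x y : adj x y -> X y -> level x < #|G| ->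
  level y <= (level x).+1 /\ level y < #|G|.
Proof. by move=> xy Xy /level_mem xb; apply: level_ball (ball_step xb xy Xy). Qed.

Lemma level_pred n y : level y = n.+1 -> n.+1 < #|G| ->
  X y /\ exists2 x, level x = n & adj x y.
Proof.
move=> ln nG; have yb := @level_mem y; rewrite ln in yb.
have yn : y \notin ball n by apply/negP=> /level_ball[]; rewrite ln ltnn.
have [Xy [x [xb xy _]]] := ball_new (yb nG) yn.
split=> //; exists x => //; have [xn xG] := level_ball xb.
have [yx _] := level_step xy Xy xG; apply/eqP; rewrite eqn_leq xn /=.
by rewrite -ltnS -ln.
Qed.

Lemma level_gt0 x : x != r -> 0 < level x.
Proof. by rewrite lt0n; apply: contraNneq => /level_eq0->. Qed.

Lemma level_far x y : X y -> level x < #|G| -> (level x).+1 < level y ->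
  ~~ adj x y.
Proof.
move=> Xy xG lt; apply/negP=> xy; have [le _] := level_step xy Xy xG.
by rewrite ltnNge le in lt.
Qed.

Lemma level_walk x s y : walk x s y -> all X s -> level x < #|G| ->
  level y < #|G|.
Proof.
elim: s x => // z s IH x /walk_consI[-> [[_ ->]//|[x' xx' w]]] /= /andP[_ Xs] xG.
have Xx' : X x' by apply: (allP Xs); exact: walk_mem_head w.
by apply: IH w Xs _; have [] := level_step xx' Xx' xG.
Qed.

End Levels.

Section Ladders.
Variables (G : sgraph) (C : seq G) (H : {set G}).
Hypothesis hS : outer_component C H.
Variables (u w w' a b c e : G) (A M R : seq G) (f : G -> nat).
Hypothesis pC : perm_eq (u :: A ++ M ++ R) C.
Hypotheses (wA : walk b A c) (wM : walk w M w') (wR : walk a R e).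
Hypotheses (ub : adj u b) (ew' : adj e w') (ua : adj u a).
Hypothesis fu : f u = 0.
Hypothesis fce : f c <= f e.
Implicit Types (x y z : G).

Let bA : b \in A ++ R. Proof. by rewrite mem_cat (walk_mem_head wA). Qed.
Let cA : c \in A ++ R. Proof. by rewrite mem_cat (walk_mem_last wA). Qed.
Let aR : a \in A ++ R.
Proof. by rewrite mem_cat (walk_mem_head wR) orbT. Qed.

Let uw : u != w.
Proof.
have : uniq (u :: A ++ M ++ R) by rewrite (perm_uniq pC) (uniqC hS).
move=> /= /andP[+ _]; apply: contraNneq => ->.
by rewrite !mem_cat (walk_mem_head wM) !orbT.
Qed.

Let neqAR x y : x \in A -> y \in R -> x != y.
Proof.
have : uniq (u :: A ++ M ++ R) by rewrite (perm_uniq pC) (uniqC hS).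
rewrite /= !cat_uniq => /and3P[_ _ /andP[/hasPn h _]] xA yR.
by apply: contraTneq yR => <-; apply/negP=> xR; have := h x; rewrite mem_cat xR
  orbT xA => /(_ isT).
Qed.

(* [s1] and [s2] traverse the same initial segments of [A] and [R] (in the
   order given by [f]), the first ending on the [A] side, the second on the
   [R] side. *)
Let ladder j : Prop := exists A1 A2 R1 R2 s1 s2 x x' y y',
  [/\ A = A1 ++ A2, R = R1 ++ R2, perm_eq s1 (u :: A1 ++ R1),
      perm_eq s2 (u :: A1 ++ R1) &
  [/\ walk u s1 x, adj x x', walk x' A2 c, f x' = j.+1 & f x = j] /\
  [/\ walk u s2 y, adj y y', walk y' R2 e & f y' = j.+1]].

Section Clique.
Hypothesis fstep : forall x y, x \in A ++ R -> y \in A ++ R -> adj x y ->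
  f y <= (f x).+1.
Hypothesis f0 : forall x, x \in A ++ R -> 0 < f x.
Hypotheses (fb : f b <= 1) (fa : f a <= 1).
Hypothesis fclique : forall x y, x \in A ++ R -> y \in A ++ R -> x != y ->
  f x = f y -> adj x y.

Let clique_ladder j : j < f c -> ladder j.
Proof.
elim: j => [|j IH] jc.
  exists [::], A, [::], R, [:: u], [:: u], u, b, u, a; rewrite walk1.
  split=> //; split; split=> //.
    by apply/eqP; rewrite eqn_leq fb f0.
  by apply/eqP; rewrite eqn_leq fa f0.
have st n p q : p <= n -> n < q -> q <= p.+1 -> p = n /\ q = n.+1.
  by clear; lia.
have [A1 [A2 [R1 [R2 [s1 [s2 [x [x' [y [y' [eA eR' p1 p2 [K1 K2]]]]]]]]]]]] :=
  IH (ltnW jc).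
case: K1 => w1 xx' wA2 fx' _; case: K2 => w2 yy' wR2 fy'.
have [||A3 [A4 [x3 [x4 [eA2 wA3 x34 wA4 [_ Px3 Px4]]]]]] :=
  @walk_cross _ (fun z => f z <= j.+1) _ _ _ wA2; rewrite ?fx' //= -?ltnNge //.
have [||R3 [R4 [y3 [y4 [eR2 wR3 y34 wR4 [_ Py3 Py4]]]]]] :=
  @walk_cross _ (fun z => f z <= j.+1) _ _ _ wR2; rewrite ?fy' //= -?ltnNge //.
  exact: leq_trans jc fce.
have mA z : z \in A2 -> z \in A ++ R by rewrite eA !mem_cat => ->; rewrite orbT.
have mR z : z \in R2 -> z \in A ++ R by rewrite eR' !mem_cat => ->; rewrite !orbT.
have x3A : x3 \in A2 by rewrite eA2 mem_cat (walk_mem_last wA3).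
have x4A : x4 \in A2 by rewrite eA2 mem_cat (walk_mem_head wA4) orbT.
have y3R : y3 \in R2 by rewrite eR2 mem_cat (walk_mem_last wR3).
have y4R : y4 \in R2 by rewrite eR2 mem_cat (walk_mem_head wR4) orbT.
have x'A := walk_mem_head wA2; have y'R := walk_mem_head wR2.
rewrite -ltnNge in Px4; rewrite -ltnNge in Py4; rewrite /= in Px3 Py3.
have [fx3 fx4] := st _ _ _ Px3 Px4 (fstep (mA _ x3A) (mA _ x4A) x34).
have [fy3 fy4] := st _ _ _ Py3 Py4 (fstep (mR _ y3R) (mR _ y4R) y34).
have nAR z t : z \in A2 -> t \in R2 -> z != t.
  by move=> zA tR; apply: neqAR; rewrite ?eA ?eR' mem_cat ?zA ?tR orbT.
exists (A1 ++ A3), A4, (R1 ++ R3), R4, (s2 ++ R3 ++ A3), (s1 ++ A3 ++ R3).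
exists x3, x4, y3, y4; split.
- by rewrite eA eA2 catA.
- by rewrite eR' eR2 catA.
- apply: (@perm_trans _ ((u :: A1 ++ R1) ++ R3 ++ A3)).
    by rewrite perm_cat2r.
  by count_tac.
- apply: (@perm_trans _ ((u :: A1 ++ R1) ++ A3 ++ R3)).
    by rewrite perm_cat2r.
  by count_tac.
split; split=> //.
- apply: walk_cat w2 yy' (walk_cat wR3 _ wA3).
  rewrite adjC; apply: fclique; [exact: mA|exact: mR|exact: nAR|by rewrite fx' fy3].
- apply: walk_cat w1 xx' (walk_cat wA3 _ wR3).
  by apply: fclique; [exact: mA|exact: mR|exact: nAR|rewrite fx3 fy'].
Qed.

Lemma clique_ladder_false : attached C H u -> attached C H w -> False.
Proof.
move=> au aw.
have : (f c).-1 < f c by have := f0 cA; case: (f c).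
case/clique_ladder=> A1 [A2 [R1 [R2 [s1 [s2 [x [x' [y [y']]]]]]]]].
case=> eA eR' p1 p2 [[w1 xx' wA2 fx' fx] [w2 yy' wR2 fy']].
have cA2 := walk_mem_last wA2; have y'R2 := walk_mem_head wR2.
have cy' : adj c y'.
  apply: fclique => //; first by rewrite eR' !mem_cat y'R2 !orbT.
    by apply: neqAR; rewrite ?eA ?eR' mem_cat ?cA2 ?y'R2 orbT.
  by rewrite fy' prednK // f0.
apply: (reroute_all hS au aw uw (q := s1 ++ A2 ++ R2 ++ rev M)).
  exact: walk_cat w1 xx' (walk_cat wA2 cy' (walk_cat wR2 ew' (walk_rev wM))).
apply: (@perm_trans _ ((u :: A1 ++ R1) ++ A2 ++ R2 ++ rev M)).
  by rewrite perm_cat2r.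
by apply: perm_trans pC; rewrite eA eR'; count_tac.
Qed.

End Clique.

Section Bipartite.
Hypothesis fstep : forall x y, x \in u :: A ++ R -> y \in u :: A ++ R ->
  adj x y -> f y = (f x).+1 \/ f x = (f y).+1.
Hypothesis fjoin : forall x y, x \in u :: A ++ R -> y \in u :: A ++ R ->
  f y = (f x).+1 -> adj x y.
Hypothesis fc : 0 < f c.

Let inAR x : x \in A ++ R -> x \in u :: A ++ R.
Proof. by rewrite inE orbC => ->. Qed.

Let bip_ladder i : i.*2 < f c -> ladder i.*2.
Proof.
elim: i => [|i IH] jc.
  exists [::], A, [::], R, [:: u], [:: u], u, b, u, a; rewrite walk1.
  split=> //; split; split=> //.
    by case: (fstep (mem_head _ _) (inAR bA) ub); rewrite fu.
  by case: (fstep (mem_head _ _) (inAR aR) ua); rewrite fu.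
have st n p q : p <= n -> n < q -> q = p.+1 \/ p = q.+1 ->
  p = n /\ q = n.+1 by clear; lia.
rewrite doubleS in jc *; set j := i.*2 in IH jc *.
have [A1 [A2 [R1 [R2 [s1 [s2 [x [x' [y [y' [eA eR' p1 p2 [K1 K2]]]]]]]]]]]] :=
  IH (ltnW (ltnW jc)).
case: K1 => w1 xx' wA2 fx' _; case: K2 => w2 yy' wR2 fy'.
have [||A3 [A4 [x3 [x4 [eA2 wA3 x34 wA4 [_ Px3 Px4]]]]]] :=
  @walk_cross _ (fun z => f z <= j.+2) _ _ _ wA2; rewrite ?fx' //= -?ltnNge //.
have [||R3 [R4 [y3 [y4 [eR2 wR3 y34 wR4 [_ Py3 Py4]]]]]] :=
  @walk_cross _ (fun z => f z <= j.+2) _ _ _ wR2; rewrite ?fy' //= -?ltnNge //.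
  exact: leq_trans jc fce.
have mA z : z \in A2 -> z \in u :: A ++ R.
  by move=> h; apply: inAR; rewrite eA !mem_cat h orbT.
have mR z : z \in R2 -> z \in u :: A ++ R.
  by move=> h; apply: inAR; rewrite eR' !mem_cat h !orbT.
have x3A : x3 \in A2 by rewrite eA2 mem_cat (walk_mem_last wA3).
have x4A : x4 \in A2 by rewrite eA2 mem_cat (walk_mem_head wA4) orbT.
have y3R : y3 \in R2 by rewrite eR2 mem_cat (walk_mem_last wR3).
have y4R : y4 \in R2 by rewrite eR2 mem_cat (walk_mem_head wR4) orbT.
have x'A := walk_mem_head wA2; have y'R := walk_mem_head wR2.
rewrite -ltnNge in Px4; rewrite -ltnNge in Py4; rewrite /= in Px3 Py3.
have [fx3 fx4] := st _ _ _ Px3 Px4 (fstep (mA _ x3A) (mA _ x4A) x34).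
have [fy3 fy4] := st _ _ _ Py3 Py4 (fstep (mR _ y3R) (mR _ y4R) y34).
exists (A1 ++ A3), A4, (R1 ++ R3), R4, (s2 ++ R3 ++ A3), (s1 ++ A3 ++ R3).
exists x3, x4, y3, y4; split.
- by rewrite eA eA2 catA.
- by rewrite eR' eR2 catA.
- apply: (@perm_trans _ ((u :: A1 ++ R1) ++ R3 ++ A3)).
    by rewrite perm_cat2r.
  by count_tac.
- apply: (@perm_trans _ ((u :: A1 ++ R1) ++ A3 ++ R3)).
    by rewrite perm_cat2r.
  by count_tac.
split; split=> //.
- apply: walk_cat w2 yy' (walk_cat wR3 _ wA3).
  by rewrite adjC; apply: fjoin; [exact: mA|exact: mR|rewrite fx' fy3].
- apply: walk_cat w1 xx' (walk_cat wA3 _ wR3).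
  by rewrite adjC; apply: fjoin; [exact: mR|exact: mA|rewrite fx3 fy'].
Qed.

(* When [f c] is odd, parity forbids a walk through all of [C] and one vertex is
   lost; the detour through [H] has to gain at least two. *)
Lemma bip_ladder_false p : 1 < p -> linked H u w p -> False.
Proof.
move=> p1' luw; pose i := (f c).-1./2.
have ic : i.*2 < f c by move: fc; rewrite /i; clear; lia.
have ci : f c <= i.*2.+2 by rewrite /i; clear; lia.
case/bip_ladder: (ic) => A1 [A2 [R1 [R2 [s1 [s2 [x [x' [y [y']]]]]]]]].
case=> eA eR' p1 p2 [[w1 xx' wA2 fx' fx] [w2 yy' wR2 fy']].
have mA z : z \in A2 -> z \in u :: A ++ R.
  by move=> h; apply: inAR; rewrite eA !mem_cat h orbT.
have mR z : z \in R2 -> z \in u :: A ++ R.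
  by move=> h; apply: inAR; rewrite eR' !mem_cat h !orbT.
have y'R2 := walk_mem_head wR2; have cA2 := walk_mem_last wA2.
have [e2|n2] := eqVneq (f c) i.*2.+2.
  have cy' : adj c y'.
    by rewrite adjC; apply: fjoin; [exact: mR|exact: mA|rewrite e2 fy'].
  apply: (reroute hS luw uw (q := s1 ++ A2 ++ R2 ++ rev M) (r := [::])).
  - exact: walk_cat w1 xx' (walk_cat wA2 cy' (walk_cat wR2 ew' (walk_rev wM))).
  - rewrite cats0; apply: (@perm_trans _ ((u :: A1 ++ R1) ++ A2 ++ R2 ++ rev M)).
      by rewrite perm_cat2r.
    by apply: perm_trans pC; rewrite eA eR'; count_tac.
  - exact: ltnW.
have fc1 : f c = i.*2.+1 by move: ic ci n2; clear; lia.
case: A2 wA2 eA mA cA2 => // x1 A5 wA2 eA mA cA2.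
have [ex1 [[eA5 ecx']|[x'' x'x'' wA5]]] := walk_consI wA2; rewrite {}ex1 in wA2 eA mA cA2.
  apply: (reroute hS luw uw (q := s2 ++ R2 ++ rev M) (r := [:: x'])) => //.
    exact: walk_cat w2 yy' (walk_cat wR2 ew' (walk_rev wM)).
  apply: (@perm_trans _ ((u :: A1 ++ R1) ++ R2 ++ rev M ++ [:: x'])).
    by rewrite -!catA perm_cat2r.
  by apply: perm_trans pC; rewrite eA eR' eA5; count_tac.
have mx : x \in u :: A ++ R.
  have := walk_mem_last w1; rewrite (perm_mem p1) eA eR' !inE !mem_cat.
  by case/or3P=> ->; rewrite ?orbT.
have x''A2 : x'' \in x' :: A5 by rewrite inE (walk_mem_head wA5) orbT.
apply: (reroute hS luw uw (q := s1 ++ rev A5 ++ R2 ++ rev M) (r := [:: x'])) => //.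
  apply: walk_cat w1 _ (walk_cat (walk_rev wA5) _ (walk_cat wR2 ew' (walk_rev wM))).
    apply: fjoin; [exact: mx|exact: mA|].
    by rewrite fx fc1.
  case: (fstep (mA _ (mem_head _ _)) (mA _ x''A2) x'x''); rewrite fx' => fx''.
    by rewrite adjC; apply: fjoin; [exact: mR|exact: mA|rewrite fx'' fy'].
  by apply: fjoin; [exact: mA|exact: mR|rewrite fy' -fx''].
apply: (@perm_trans _ ((u :: A1 ++ R1) ++ rev A5 ++ R2 ++ rev M ++ [:: x'])).
  by rewrite -!catA perm_cat2r.
by apply: perm_trans pC; rewrite eA eR'; count_tac.
Qed.

End Bipartite.
End Ladders.

(** * Attachments of a component *)

Section Attachments.
Variables (G : sgraph) (C : seq G) (H : {set G}).
Hypothesis hS : outer_component C H.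
Implicit Types (u v w x y z h : G) (A B M R s q : seq G).

Local Notation att := (attached C H).

Definition unattached x : bool := (x \in C) && ~~ att x.

Local Notation natt := unattached.

Lemma natt_adj x h : natt x -> h \in H -> ~~ adj x h.
Proof.
case/andP=> xC nx hH; apply: contra nx => xh; rewrite /attached xC.
by apply/exists_inP; exists h.
Qed.

Lemma natt_adj' x h : natt x -> h \in H -> ~~ adj h x.
Proof. by rewrite adjC; exact: natt_adj. Qed.

Lemma nattC x : natt x -> x \in C.
Proof. by case/andP. Qed.

Lemma att_intro u h : u \in C -> h \in H -> adj u h -> att u.
Proof. by move=> uC hH uh; rewrite /attached uC; apply/exists_inP; exists h. Qed.

Lemma rotated u : u \in C -> exists s b a,
  [/\ perm_eq (u :: s) C, walk b s a, adj u b & adj a u].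
Proof.
move=> uC; have [i s e] := rot_to uC.
have p : perm_eq (u :: s) C by rewrite -e perm_rot.
have cy : cycle (@adj G) (u :: s).
  by rewrite -e rot_cycle; case: hS => [[_ /andP[]]].
have [a w au] := cycle_walk cy.
have [_ [[s0 _]|[b ub wb]]] := walk_consI w; last by exists s, b, a.
by have := sizeC hS; rewrite -(perm_size p) s0.
Qed.

Lemma att_consecutive u s b a : att u -> perm_eq (u :: s) C -> walk b s a ->
  adj u b -> adj a u -> natt b.
Proof.
move=> au p w ub au'.
have bC : b \in C by rewrite -(perm_mem p) inE (walk_mem_head w) orbT.
rewrite /unattached bC /=; apply/negP=> ab.
apply: (reroute_all hS ab au (q := rcons s u)).
- by rewrite eq_sym (adj_neq ub).
- exact: walk_rcons w au'.
- by rewrite perm_rcons.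
Qed.

Lemma att_nbr u : att u -> exists2 b, adj u b & natt b.
Proof.
move=> au; have [s [b [a [p w ub au']]]] := rotated (attC au).
by exists b => //; exact: att_consecutive au p w ub au'.
Qed.

(* [M] lies between the first vertices of [W] met from [u] on either side; note
   that [R] is read backwards. *)
Lemma two_sided (W : pred G) u w : att u -> ~~ W u -> w \in C -> W w ->
  (forall x, W x -> x \in C -> att x) ->
  exists A M R b c w1 w2 e a,
  [/\ perm_eq (u :: A ++ M ++ R) C,
      [/\ walk b A c, walk w1 M w2 & walk a R e],
      [/\ adj u b, adj c w1, adj e w2 & adj u a],
      [/\ W w1, W w2, w1 \in C & w2 \in C] &
      [/\ natt b, natt c, natt e, natt a & forall x, x \in A ++ R -> ~~ W x]].
Proof.
move=> au nWu wC Ww Watt; have [s [b [a [p ws ub au']]]] := rotated (attC au).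
have nb := att_consecutive au p ws ub au'.
have na : natt a.
  apply: (att_consecutive (s := rev s) (a := b) au).
  - by perm_tac p.
  - exact: walk_rev.
  - by rewrite adjC.
  - by rewrite adjC.
have nW x : natt x -> ~~ W x.
  by case/andP=> xC; apply: contra => /Watt; apply.
have ws' : w \in s.
  move: wC; rewrite -(perm_mem p) inE => /orP[/eqP e|//].
  by rewrite e (negbTE nWu) in Ww.
have [||A [t [c [w1 [es wA cw1 wt [aA _ Ww1]]]]]] :=
  @walk_first _ (fun z => ~~ W z) _ _ _ ws.
- exact: nW.
- by apply/allPn; exists w; rewrite ?negbK.
have [||R [Q [e [w2 [et wR ew2 wQ [aR _ Ww2]]]]]] :=
  @walk_first _ (fun z => ~~ W z) _ _ _ (walk_rev wt).
- exact: nW.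
- by apply/allPn; exists w1; rewrite ?mem_rev ?(walk_mem_head wt).
rewrite negbK in Ww1; rewrite negbK in Ww2.
have pAR : perm_eq (u :: A ++ rev Q ++ R) C.
  have et' : t = rev Q ++ rev R by rewrite -rev_cat -et revK.
  by move: p; rewrite es et' => p; perm_tac p.
have mw1 : w1 \in C.
  by rewrite -(perm_mem pAR) inE !mem_cat mem_rev (walk_mem_last wQ) !orbT.
have mw2 : w2 \in C.
  by rewrite -(perm_mem pAR) inE !mem_cat mem_rev (walk_mem_head wQ) !orbT.
exists A, (rev Q), R, b, c, w1, w2, e, a; split=> //.
- by split=> //; exact: walk_rev.
- by split=> //; rewrite adjC.
split=> //; last by move=> x; rewrite mem_cat => /orP[/(allP aA)|/(allP aR)].
  rewrite /unattached -(perm_mem pAR) inE mem_cat (walk_mem_last wA) orbT /=.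
  apply/negP=> ac; apply: (reroute_all hS ac (Watt _ Ww1 mw1)
    (q := rev A ++ u :: R ++ Q)).
  - exact: adj_neq.
  - apply: walk_cat (walk_rev wA) _ (walk_cons _ (walk_cat wR ew2 wQ)); by rewrite adjC.
  - by perm_tac pAR.
rewrite /unattached -(perm_mem pAR) inE !mem_cat (walk_mem_last wR) !orbT /=.
apply/negP=> ae; apply: (reroute_all hS ae (Watt _ Ww2 mw2)
  (q := rev R ++ u :: A ++ rev Q)).
- exact: adj_neq.
- apply: walk_cat (walk_rev wR) au' (walk_cons ub (walk_cat wA cw1 (walk_rev wQ))).
- by perm_tac pAR.
Qed.

Lemma arr_natt u A w B b c d a : att u -> arr C u A w B b c d a -> natt b.
Proof.
move=> au [wA wB [ub cw wd au'] p].
exact: att_consecutive au p (walk_cat wA cw (walk_cons wd wB)) ub au'.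
Qed.

Lemma arr_natts u A w B b c d a : att u -> att w -> arr C u A w B b c d a ->
  [/\ natt b, natt c, natt d & natt a].
Proof.
move=> au aw h; split; first exact: arr_natt au h.
- exact: arr_natt aw (arr_swap (arr_rev h)).
- exact: arr_natt aw (arr_swap h).
- exact: arr_natt au (arr_rev h).
Qed.

Lemma arr_exists u w : att u -> att w -> u != w -> exists A B b c d a,
  arr C u A w B b c d a.
Proof.
move=> au aw uw; have [s [b [a [p ws ub au']]]] := rotated (attC au).
have wS : w \in s.
  by have := attC aw; rewrite -(perm_mem p) inE eq_sym (negbTE uw).
case/splitPr: s / wS p ws => A B p ws.
have cy : cycle (@adj G) (u :: A ++ w :: B).
  by apply: (@walk_cycle _ u _ a) => //; exact: walk_cons ub ws.
by have [b' [c [d [a' h]]]] := arr_intro hS au aw cy p; exists A, B, b', c, d, a'.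
Qed.

Lemma arr_bd u A w B b c d a : att u -> att w -> arr C u A w B b c d a ->
  ~~ adj b d.
Proof.
move=> au aw h; have uw := arr_neq hS h; case: h => wA wB [ub cw wd au'] p.
apply/negP=> bd; apply: (reroute_all hS au aw uw (q := u :: rev B ++ A ++ [:: w])).
  apply: walk_cons (walk_cat (walk_rev wB) _ (walk_cat wA cw (walk1 w))).
    by rewrite adjC.
  by rewrite adjC.
by perm_tac p.
Qed.

Lemma arr_ac u A w B b c d a : att u -> att w -> arr C u A w B b c d a ->
  ~~ adj a c.
Proof. by move=> au aw /arr_rev; exact: arr_bd. Qed.

Lemma arc_size u A w B b c d a p : arr C u A w B b c d a -> linked H u w p ->
  p <= size A.
Proof.
move=> h l; have uw := arr_neq hS h; case: h => wA wB [ub cw wd au] pC.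
rewrite leqNgt; apply/negP=> lt.
apply: (reroute hS l uw (q := u :: rev B ++ [:: w]) _ _ lt).
  apply: walk_cons (walk_cat (walk_rev wB) _ (walk1 w)); first by rewrite adjC.
  by rewrite adjC.
by perm_tac pC.
Qed.

Lemma walk_second A b c : walk b A c -> 1 < size A ->
  exists A' b2, [/\ A = b :: A', adj b b2 & walk b2 A' c].
Proof.
case: A => // x A w sA; have [-> [[e _]|[b2 bb2 w2]]] := walk_consI w.
  by rewrite e in sA.
by exists A, b2.
Qed.

Lemma arr_first u : att u -> exists A w B b c d a,
  [/\ arr C u A w B b c d a, att w & forall x, x \in A -> natt x].
Proof.
move=> au; have [_ _ _ _ /(_ u)[w0 [h0 [w0C h0H wh0 w0u _]]]] := hS.
have Ww : att w0 && (w0 != u) by rewrite w0u (att_intro w0C h0H wh0).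
have nWu : ~~ (att u && (u != u)) by rewrite eqxx andbF.
have Watt x : att x && (x != u) -> x \in C -> att x by case/andP.
have [A [M [R [b [c [w [w2 [e [a]]]]]]]]] :=
  two_sided (W := fun x => att x && (x != u)) au nWu w0C Ww Watt.
case=> p [wA wM wR] [ub cw ew ua] [/andP[aw wu] _ wC _] [_ _ _ _ nAR].
case: M wM p => // m M wM; have [em _] := walk_consI wM; rewrite {m}em in wM *.
move=> p.
have cy : cycle (@adj G) (u :: A ++ w :: (M ++ rev R)).
  apply: (@walk_cycle _ u _ a); last by rewrite adjC.
  apply: walk_cons ub (walk_cat wA cw _); rewrite -cat_cons.
  by apply: walk_cat wM _ (walk_rev wR); rewrite adjC.
have p' : perm_eq (u :: A ++ w :: (M ++ rev R)) C by perm_tac p.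
have [b' [c' [d [a' h]]]] := arr_intro hS au aw cy p'.
exists A, w, (M ++ rev R), b', c', d, a'; split=> // x xA.
have xC : x \in C by rewrite -(perm_mem p') inE mem_cat xA orbT.
rewrite /unattached xC; have := nAR x; rewrite mem_cat xA => /(_ isT).
rewrite negb_and negbK => /orP[//|/eqP xu].
by have := arr_uniq hS h; rewrite /= mem_cat -xu xA.
Qed.

End Attachments.

(** * The pair $P_4$, $W$ *)

Ltac adj_auto := first
  [ assumption | rewrite adjC; assumption
  | eapply natt_adj; eassumption | eapply natt_adj'; eassumption ].

Section P4W.
Variables (Hs : seq sgraph) (G : sgraph) (C : seq G) (H : {set G}).
Hypothesis hfree : free Hs G.
Hypotheses (inP4 : List.In (path_graph 4) Hs) (inW : List.In graph_W Hs).
Hypothesis hS : outer_component C H.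
Implicit Types (u w x y h : G).

Let att_complete u h : attached C H u -> h \in H -> adj u h.
Proof.
move=> au hH; apply/negPn/negP=> uh.
have /attP[uC [h0 h0H uh0]] := au.
have [_ _ [_ _ /(_ h0 h h0H hH)[s [ws _ sub]]] _ _] := hS.
have [s1 [s2 [z [z' [es w1 zz' w2 [_ uz uz']]]]]] :=
  walk_cross (P := adj u) ws uh0 uh.
have [b ub nb] := att_nbr hS au.
have zH : z \in H by apply: sub; rewrite es mem_cat (walk_mem_last w1).
have z'H : z' \in H by apply: sub; rewrite es mem_cat (walk_mem_head w2) orbT.
apply: (P4_free hfree (a := b) (b := u) (c := z) (d := z') inP4); adj_auto.
Qed.

Let spread w c s b : attached C H w -> walk c s b -> adj w c -> all (unattached C H) s ->
  all (adj w) s.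
Proof.
move=> aw; elim: s c => // x s IH c /walk_consI[-> [[-> _]|[x' cx' ws]]] wc /=.
  by rewrite wc.
case/andP=> nc ns; rewrite wc; apply: (IH _ ws _ ns); apply/negPn/negP=> wx'.
have nx' : unattached C H x' by apply: (allP ns); exact: walk_mem_head ws.
have /attP[_ [h hH wh]] := aw.
apply: (P4_free hfree (a := h) (b := w) (c := c) (d := x') inP4); adj_auto.
Qed.

Lemma P4W_false : False.
Proof.
have [_ _ _ [h1 [h2 [h1H h2H h12]]] an] := hS.
have [u1 [h [u1C hH u1h _ _]]] := an h1.
have au1 := att_intro u1C hH u1h.
have [A [w [B [b [c [d [a [h4 aw natA]]]]]]]] := arr_first hS au1.
have bd := arr_bd hS au1 aw h4.
have [nb nc nd na] := arr_natts hS au1 aw h4.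
have u1w := arr_neq hS h4.
have l2 x y : attached C H x -> attached C H y -> linked H x y 2.
  move=> ax ay; exact: (linked_edge h1H h2H h12 (att_complete ax h1H)
    (att_complete ay h2H)).
case: (h4) => wA wB [ub cw wd au] p.
have [A' [b2 [eA bb2 wA2]]] := walk_second wA (arc_size hS h4 (l2 _ _ au1 aw)).
have [B' [d2 [eB dd2 wB2]]] :=
  walk_second wB (arc_size hS (arr_swap h4) (l2 _ _ aw au1)).
have b2A' := walk_mem_head wA2; have d2B' := walk_mem_head wB2.
have b2A : b2 \in A by rewrite eA inE b2A' orbT.
have d2B : d2 \in B by rewrite eB inE d2B' orbT.
have nd2 : unattached C H d2.
  have d2C : d2 \in C by rewrite -(perm_mem p) inE mem_cat inE d2B !orbT.
  rewrite /unattached d2C; apply/negP=> ad2.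
  have : uniq (u1 :: A ++ w :: B) by rewrite (perm_uniq p) (uniqC hS).
  rewrite /= cat_uniq /= => /and5P[_ _ _ wB' _].
  apply: (reroute hS (l2 _ _ aw ad2) (q := w :: rev A ++ u1 :: rev B')
    (r := [:: d])) => //.
  - by apply: contraNneq wB' => ->.
  - apply: walk_cons (walk_cat (walk_rev wA) _ (walk_cons _ (walk_rev wB2)));
      by rewrite adjC.
  - by rewrite eB in p; perm_tac p.
have wall : all (adj w) (rev A).
  apply: (spread aw (walk_rev wA)); first by rewrite adjC.
  by apply/allP=> x; rewrite mem_rev; exact: natA.
have wb : adj w b.
  by apply: (allP wall); rewrite mem_rev (walk_mem_head wA).
have wb2 : adj w b2 by apply: (allP wall); rewrite mem_rev.
have wd2 : adj w d2.
  have /= := spread aw (walk_cons dd2 (walk1 d2)) wd.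
  by rewrite nd nd2 /= => /(_ isT) /and3P[].
have nb2 := natA _ b2A.
have b2d : ~~ adj b2 d.
  apply/negP=> b2d; apply: (reroute hS (l2 _ _ au1 aw) u1w
    (q := u1 :: rev B ++ A' ++ [:: w]) (r := [:: b])) => //.
  - by apply: walk_cons (walk_cat (walk_rev wB) _ (walk_cat wA2 cw (walk1 w)));
      rewrite adjC.
  - by rewrite eA in p; perm_tac p.
have bd2 : ~~ adj b d2.
  apply/negP=> bd2; apply: (reroute hS (l2 _ _ au1 aw) u1w
    (q := u1 :: rev B' ++ A ++ [:: w]) (r := [:: d])) => //.
  - by apply: walk_cons (walk_cat (walk_rev wB2) _ (walk_cat wA cw (walk1 w)));
      rewrite adjC.
  - by rewrite eB in p; perm_tac p.
have [b2d2|b2d2] := boolP (adj b2 d2).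
  by apply: (P4_free hfree (a := b) (b := b2) (c := d2) (d := d) inP4); adj_auto.
by apply: (W_free hfree (u := w) (x1 := h1) (x2 := h2) (y1 := b) (y2 := b2)
  (z1 := d) (z2 := d2) inW); first [adj_auto | exact: att_complete].
Qed.

End P4W.

(** * The pair $K_{1,3}^{**}$, $Z_1$ *)

Section PawFree.
Variables (Hs : seq sgraph) (G : sgraph).
Hypothesis hfree : free Hs G.
Hypothesis inZ : List.In (graph_Z 1) Hs.
Hypothesis conn : k_connected 2 G.
Implicit Types (a b c v w x y z : G).

Let paw a b c v : adj a b -> adj a c -> adj b c -> adj a v ->
  adj b v || adj c v.
Proof.
move=> ab ac bc av; apply/negPn/negP; rewrite negb_or => /andP[bv cv].
by apply: (Z1_free hfree (a := a) (b := b) (c := c) (p := v) inZ).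
Qed.

Let two_of_three a b c v : bool :=
  [|| adj a v && adj b v, adj a v && adj c v | adj b v && adj c v].

Lemma paw_triangle a b c v : adj a b -> adj a c -> adj b c -> two_of_three a b c v.
Proof.
move=> ab ac bc; apply/negPn/negP=> nv.
have Qa : two_of_three a b c a.
  by rewrite /two_of_three (adjC b a) ab (adjC c a) ac /= !orbT.
have va : v != a by apply: contraNneq nv => ->.
have [z za zv] : exists2 z, a != z & v != z.
  have [vb|vb] := eqVneq v b; last by exists b; rewrite ?(adj_neq ab).
  by exists c; rewrite ?vb ?(adj_neq ac) ?(adj_neq bc).
have [x [y [xy Qx nQy _ _]]] := delete1_cross conn za zv Qa nv.
have one s : [|| adj a s, adj b s | adj c s] -> two_of_three a b c s.
  rewrite /two_of_three; case/or3P=> h.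
  - by have := paw ab ac bc h; rewrite h => /orP[] ->; rewrite ?orbT.
  - by have := @paw b a c s; rewrite adjC ab bc ac h => /(_ isT isT isT isT);
      case/orP=> ->; rewrite ?orbT.
  - by have := @paw c a b s; rewrite (adjC c a) (adjC c b) ab bc ac h =>
      /(_ isT isT isT isT); case/orP=> ->; rewrite ?orbT.
case/negP: nQy; apply: one.
case/or3P: Qx => /andP[h1 h2].
- by have := @paw x a b y; rewrite ![adj x _]adjC h1 h2 ab (adjC y) xy =>
    /(_ isT isT isT isT) /orP[] ->; rewrite ?orbT.
- by have := @paw x a c y; rewrite ![adj x _]adjC h1 h2 ac (adjC y) xy =>
    /(_ isT isT isT isT) /orP[] ->; rewrite ?orbT.
- by have := @paw x b c y; rewrite ![adj x _]adjC h1 h2 bc (adjC y) xy =>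
    /(_ isT isT isT isT) /orP[] ->; rewrite ?orbT.
Qed.

(* A connected paw-free graph with a triangle is complete multipartite. *)
Lemma paw_edge a b c x y v : adj a b -> adj a c -> adj b c -> adj x y ->
  adj x v || adj y v.
Proof.
move=> ab ac bc xy.
have [s [t [xs xt st]]] : exists s t, [/\ adj x s, adj x t & adj s t].
  have /or3P[] := paw_triangle x ab ac bc => /andP[h1 h2];
  [exists a, b|exists a, c|exists b, c]; by rewrite (adjC x) h1 (adjC x) h2.
have [z xz yz] : exists2 z, adj x z & adj y z.
  have /orP[h|h] := paw xs xt st xy; [exists s|exists t] => //; by rewrite adjC.
have /or3P[] := paw_triangle v xy xz yz => /andP[h1 h2];
  by rewrite ?h1 ?h2 ?orbT.
Qed.

Lemma paw_triangle_false C (H : {set G}) a b c : outer_component C H -> adj a b ->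
  adj a c -> adj b c -> False.
Proof.
move=> hS ab ac bc; have [_ _ _ [h1 [h2 [h1H h2H h12]]] an] := hS.
have [u [h [uC hH uh _ _]]] := an h1.
have [x ux nx] := att_nbr hS (att_intro uC hH uh).
have := paw_edge x ab ac bc h12.
by rewrite (negbTE (natt_adj' nx h1H)) (negbTE (natt_adj' nx h2H)).
Qed.

End PawFree.

Section TriangleFree.
Variables (Hs : seq sgraph) (G : sgraph) (C : seq G) (H : {set G}).
Hypothesis hfree : free Hs G.
Hypothesis inS : List.In claw_star_star Hs.
Hypothesis hS : outer_component C H.
Hypothesis tf : forall x y z : G, adj x y -> adj x z -> adj y z -> False.
Implicit Types (u v w x y z h t r : G) (A B M R s q : seq G).

Let ntf x y z : adj x y -> adj x z -> ~~ adj y z.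
Proof. by move=> xy xz; apply/negP=> yz; exact: tf xy xz yz. Qed.

Lemma spider (v l p1 p2 q1 q2 : G) : adj v l -> adj v p1 -> adj v q1 -> adj p1 p2 ->
  adj q1 q2 -> ~~ adj l p2 -> ~~ adj l q2 -> ~~ adj p1 q2 -> ~~ adj p2 q1 ->
  ~~ adj p2 q2 -> False.
Proof.
move=> vl vp vq pp qq lp lq pq qp pq2.
apply: (spider_free hfree (v := v) (l := l) (p1 := p1) (p2 := p2) (q1 := q1)
  (q2 := q2) inS) => //; first [exact: ntf vl vp | exact: ntf vl vq
  | exact: ntf vp vq | by apply: (ntf _ pp); rewrite adjC
  | by apply: (ntf _ qq); rewrite adjC].
Qed.

Section Chain.
Variables (X : pred G) (r t1 t2 : G).
Local Notation f := (level X r).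
Hypotheses (rt1 : adj r t1) (t12 : adj t1 t2).
Hypothesis X1 : forall x, X x -> x != r -> ~~ adj t1 x.
Hypothesis X2 : forall x, X x -> (f x == 1) || (f x == 2) -> ~~ adj t2 x.

Let not_root x n : f x = n.+1 -> x != r.
Proof. by move=> e; apply/eqP=> xr; rewrite xr level_root in e. Qed.

Lemma chain_join j x y : f x = j -> f y = j.+1 -> j.+1 < #|G| -> adj x y.
Proof.
elim: j x y => [|j IH] x y fx fy lt.
  have [_ [x' fx' xy]] := level_pred fy lt.
  by rewrite (level_eq0 fx) -(level_eq0 fx').
have ltj := ltnW lt.
have [Xy [p fp py]] := level_pred fy lt.
have [Xp [b fb bp]] := level_pred fp ltj.
have [Xx _] := level_pred fx ltj.
have bx : adj b x by apply: IH.
apply/negPn/negP=> xy.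
have far n n' z z' : f z = n -> f z' = n' -> n.+1 < n' -> n < #|G| -> X z' ->
    ~~ adj z' z.
  by move=> fz fz' nn' nG Xz'; rewrite adjC; apply: (@level_far _ X r) => //;
    rewrite ?fz ?fz'.
case: j IH fx fy fp fb lt ltj => [|j] IH fx fy fp fb lt ltj.
  move: bp bx; rewrite (level_eq0 fb) => rp rx.
  apply: (spider rx rp rt1 py t12) => //.
  - by rewrite adjC; apply: X2; rewrite ?fx.
  - by rewrite adjC; apply: X2; rewrite ?fp.
  - by rewrite adjC; apply: X1 => //; exact: not_root fy.
  - by rewrite adjC; apply: X2; rewrite ?fy.
have [Xb [b1 fb1 b1b]] := level_pred fb (ltnW ltj).
have bb1 : adj b b1 by rewrite adjC.
case: j IH fx fy fp fb fb1 lt ltj => [|j] IH fx fy fp fb fb1 lt ltj.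
  rewrite (level_eq0 fb1) in bb1.
  apply: (spider bx bp bb1 py rt1) => //.
  - by rewrite adjC; apply: X1 => //; exact: not_root fx.
  - by rewrite adjC; apply: X1 => //; exact: not_root fp.
  - by apply: (far _ _ _ _ (level_root X r) fy) => //; exact: leq_ltn_trans lt.
  - by rewrite adjC; apply: X1 => //; exact: not_root fy.
have [_ [b2 fb2 b21]] := level_pred fb1 (ltnW (ltnW ltj)).
have b12 : adj b1 b2 by rewrite adjC.
apply: (spider bx bp bb1 py b12) => //.
- by apply: (far _ _ _ _ fb2 fx) => //; move: lt; clear; lia.
- by apply: (far _ _ _ _ fb2 fp) => //; move: lt; clear; lia.
- by apply: (far _ _ _ _ fb1 fy) => //; move: lt; clear; lia.
- by apply: (far _ _ _ _ fb2 fy) => //; move: lt; clear; lia.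
Qed.

Lemma chain_step x y : X x -> X y -> f x < #|G| -> adj x y ->
  f y = (f x).+1 \/ f x = (f y).+1.
Proof.
move=> Xx Xy lx xy; have [lyx ly] := level_step xy Xy lx.
have yx : adj y x by rewrite adjC.
have [lxy _] := level_step yx Xx ly.
have [e|ne] := eqVneq (f x) (f y); last first.
  by move: lyx lxy ne; clear; lia.
have [e0|n0] := posnP (f x).
  by move: xy; rewrite (level_eq0 e0) (level_eq0 (etrans (esym e) e0)) adjxx.
have ex : f x = (f x).-1.+1 by rewrite prednK.
have [_ [p fp px]] := level_pred ex (eq_ind _ (fun n => n < #|G|) lx _ ex).
have py : adj p y by apply: (chain_join fp); rewrite -?e -?ex.
by case: (tf px py xy).
Qed.

End Chain.
Lemma chain_false (W : pred G) u r t1 t2 w (X := fun x => (x \in C) && ~~ W x) :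
  attached C H u -> ~~ W u -> w \in C -> W w ->
  (forall x, W x -> x \in C -> attached C H x) ->
  adj r t1 -> adj t1 t2 ->
  (forall x, X x -> x != r -> ~~ adj t1 x) ->
  (forall x, X x -> (level X r x == 1) || (level X r x == 2) -> ~~ adj t2 x) ->
  r = u \/ r \in H /\ adj r u ->
  (forall x, x \in C -> W x -> exists2 p, 1 < p & linked H u x p) -> False.
Proof.
move=> au nWu wC Ww Watt rt1 t12 X1 X2 root lnk.
set f := level X r; have uC := attC au.
have Xu : X u by rewrite /X uC.
have G0 : 0 < #|G| by apply/card_gt0P; exists u.
have fu : f u < #|G| /\ f u = (r != u).
  case: root => [ru|[rH ru]]; first by rewrite /f ru level_root eqxx.
  have [] := @level_step _ X r _ _ ru Xu; rewrite level_root // => l1 l2.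
  have ur : u != r by rewrite eq_sym adj_neq.
  split=> //; apply/eqP; rewrite eqn_leq eq_sym ur l1 /=.
  exact: level_gt0.
case: fu; set d : nat := r != u => fuG fu.
have fd x : x \in C -> d <= f x.
  rewrite /d; case: eqP => [//|ru] xC; apply: level_gt0.
  have rH : r \in H by case: root => [/ru//|[]].
  by apply: contraTneq xC => ->; have := notinC hS rH.
have fnatt x : unattached C H x -> f x < #|G| -> f x != d.
  move=> nx fxG; apply/eqP; rewrite /d; case: eqP => [ru|ru] fx.
    by move: nx; rewrite (level_eq0 fx) ru /unattached au andbF.
  have rH : r \in H by case: root => [/ru//|[]].
  rewrite fx in fxG.
  have [_ [x' fx' x'x]] := level_pred fx fxG.
  by move: x'x; rewrite (level_eq0 fx') (negbTE (natt_adj' nx rH)).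
have [A [M [R [b [c [w1 [w2 [e [a]]]]]]]]] := two_sided hS au nWu wC Ww Watt.
case=> p [wA wM wR] [ub cw ew ua] [Ww1 Ww2 w1C w2C] [nb nc ne na nAR].
have inC x : x \in u :: A ++ R -> x \in C.
  by rewrite -(perm_mem p) !inE !mem_cat => /or3P[] ->; rewrite ?orbT.
have inX x : x \in u :: A ++ R -> X x.
  move=> xm; rewrite /X inC //=; move: xm; rewrite inE => /orP[/eqP->//|].
  exact: nAR.
have reach s x y : walk x s y -> adj u x -> {subset s <= u :: A ++ R} ->
    forall z, z \in s -> f z < #|G|.
  move=> ws ux sub z zs; case/splitPr: s / zs ws sub => s1 s2 ws sub.
  have [z' wz] : exists z', walk x (rcons s1 z) z'.
    rewrite -cat1s catA cats1 in ws; case: s2 ws sub => [|z2 s2] ws sub.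
      by exists y; rewrite cats0 in ws.
    have s10 : rcons s1 z != [::] by case: (s1).
    by have [z' [? [? _ _]]] := walk_catI ws s10 isT; exists z'.
  have [ez _] := walk_rconsI wz; rewrite -ez in wz *.
  apply: (@level_walk _ X r u (u :: rcons s1 z)) => //.
    exact: walk_cons ux wz.
  rewrite /= Xu; apply/allP=> t; rewrite mem_rcons inE => ts.
  by apply/inX/sub; rewrite mem_cat inE orbCA; case/orP: ts => ->; rewrite ?orbT.
have sA : {subset A <= u :: A ++ R} by move=> z; rewrite inE mem_cat => ->; rewrite orbT.
have sR : {subset R <= u :: A ++ R} by move=> z; rewrite inE mem_cat => ->; rewrite !orbT.
have fG x : x \in u :: A ++ R -> f x < #|G|.
  rewrite inE mem_cat => /or3P[/eqP->//||]; first exact: reach wA ub sA x.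
  exact: reach wR ua sR x.
pose g x := f x - d.
have gf x : x \in u :: A ++ R -> f x = g x + d.
  by move=> /inC /fd; rewrite /g => /subnK.
have g0 : g u = 0 by rewrite /g fu subnn.
have gstep x y : x \in u :: A ++ R -> y \in u :: A ++ R -> adj x y ->
    g y = (g x).+1 \/ g x = (g y).+1.
  move=> xm ym xy.
  have := chain_step rt1 t12 X1 X2 (inX _ xm) (inX _ ym) (fG _ xm) xy.
  by rewrite -/f (gf x) // (gf y) // -!addSn => -[/addIn|/addIn] ->; [left|right].
have gjoin x y : x \in u :: A ++ R -> y \in u :: A ++ R -> g y = (g x).+1 ->
    adj x y.
  move=> xm ym e'; apply: (chain_join rt1 t12 X1 X2 (j := f x)) => //.
    by rewrite -/f (gf y) // (gf x) // e' addSn.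
  by have := fG _ ym; rewrite (gf y) // (gf x) // e' addSn.
have gpos x : unattached C H x -> x \in u :: A ++ R -> 0 < g x.
  move=> nx xm; rewrite subn_gt0 ltn_neqAle eq_sym (fnatt _ nx) ?fG //=.
  exact/fd/inC.
have cA : c \in u :: A ++ R by apply: sA; exact: walk_mem_last wA.
have eR : e \in u :: A ++ R by apply: sR; exact: walk_mem_last wR.
have [le|/ltnW le] := leqP (g c) (g e).
  have [q q1 l] := lnk _ w1C Ww1.
  exact: (bip_ladder_false hS p wA wM wR ub ew ua g0 le gstep gjoin (gpos _ nc cA) q1 l).
have [q q1 l] := lnk _ w2C Ww2.
have sw x : (x \in u :: R ++ A) = (x \in u :: A ++ R).
  by rewrite !inE !mem_cat [(x \in R) || _]orbC.
have p' : perm_eq (u :: R ++ rev M ++ A) C by perm_tac p.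
apply: (bip_ladder_false hS p' wR (walk_rev wM) wA ua cw ub g0 le _ _ (gpos _ ne eR) q1 l).
  by move=> x y; rewrite !sw; exact: gstep.
by move=> x y; rewrite !sw; exact: gjoin.
Qed.

End TriangleFree.

Section Edge.
Variables (Hs : seq sgraph) (G : sgraph) (C : seq G) (H : {set G}).
Hypothesis hfree : free Hs G.
Hypothesis inS : List.In claw_star_star Hs.
Hypothesis hS : outer_component C H.
Hypothesis tf : forall x y z : G, adj x y -> adj x z -> adj y z -> False.
Implicit Types (u v w x y z t r : G) (A B M R s q : seq G).

Let spider := spider hfree inS tf.

Section Oriented.
Variables h1 h2 : G.
Hypotheses (h1H : h1 \in H) (h2H : h2 \in H) (h12 : adj h1 h2).

Let h21 : adj h2 h1. Proof. by rewrite adjC. Qed.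

Let l2 u v : adj u h1 -> adj v h2 -> linked H u v 2.
Proof. exact: linked_edge. Qed.

Let att1 u : u \in C -> adj u h1 -> attached C H u.
Proof. by move=> uC; exact: att_intro. Qed.

Let att2 u : u \in C -> adj u h2 -> attached C H u.
Proof. by move=> uC; exact: att_intro. Qed.

Lemma not_both x : adj x h1 -> ~~ adj x h2.
Proof. by move=> x1; apply/negP=> x2; exact: tf x1 x2 h12. Qed.

Let arr1 u A v B b c d a : arr C u A v B b c d a -> u \in C.
Proof. by case=> _ _ _ /perm_mem <-; rewrite mem_head. Qed.

Let arr2 u A v B b c d a : arr C u A v B b c d a -> v \in C.
Proof. by case=> _ _ _ /perm_mem <-; rewrite inE mem_cat mem_head !orbT. Qed.

Let arr_natts' u A v B b c d a : arr C u A v B b c d a -> adj u h1 ->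
  adj v h2 -> [/\ unattached C H b, unattached C H c, unattached C H d & unattached C H a].
Proof.
move=> h u1 v2; apply: (arr_natts hS _ _ h).
  exact: att1 (arr1 h) u1.
exact: att2 (arr2 h) v2.
Qed.

Let second_far u A v B b c d a A' b2 : arr C u A v B b c d a -> adj u h1 ->
  adj v h2 -> A = b :: A' -> walk b2 A' c -> ~~ adj b2 d.
Proof.
move=> h u1 v2 eA wA'; apply/negP=> b2d; have uv := arr_neq hS h.
case: h => wA wB [ub cv vd au] p.
apply: (reroute hS (l2 u1 v2) uv (q := u :: rev B ++ A' ++ [:: v]) (r := [:: b])) => //.
  by apply: walk_cons (walk_cat (walk_rev wB) _ (walk_cat wA' cv (walk1 v)));
    rewrite adjC.
by rewrite eA in p; perm_tac p.
Qed.

Let second_not2 u A v B b c d a A' b2 : arr C u A v B b c d a -> adj u h1 ->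
  A = b :: A' -> walk b2 A' c -> ~~ adj b2 h2.
Proof.
move=> h u1 eA wA'; apply/negP=> b2h; have un := arr_uniq hS h.
case: h => wA wB [ub cv vd au] p.
apply: (reroute hS (l2 u1 b2h) _ (q := u :: rev B ++ v :: rev A') (r := [:: b])) => //.
- by apply: contraTneq b2h => <-; exact: not_both.
- by apply: walk_cons (walk_cat (walk_rev wB) _ (walk_cons _ (walk_rev wA')));
    rewrite adjC.
- by rewrite eA in p; perm_tac p.
Qed.

Lemma common_second u A v B b c d a A' b2 x : arr C u A v B b c d a ->
  adj u h1 -> adj v h2 -> adj u x -> adj v x -> A = b :: A' -> adj b b2 ->
  walk b2 A' c -> adj b2 h1.
Proof.
move=> h u1 v2 ux vx eA bb2 wA'; apply/negPn/negP=> n1.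
have n2 := second_not2 h u1 eA wA'; have nd := second_far h u1 v2 eA wA'.
have [nb _ ndd _] := arr_natts' h u1 v2; case: (h) => _ _ [ub _ vd _] _.
have xh1 : ~~ adj x h1 by apply/negP=> x1; exact: tf ux u1 x1.
have xh2 : ~~ adj x h2 by apply/negP=> x2; exact: tf vx v2 x2.
have xb2 : adj x b2.
  apply/negPn/negP=> xb2; apply: (spider ux ub u1 bb2 h12) => //.
  exact: natt_adj nb h2H.
apply: (spider vd vx v2 xb2 h21) => //; first by rewrite adjC.
exact: natt_adj ndd h1H.
Qed.

Lemma common_next u A v B b c d a A1 A2 x y : arr C u A v B b c d a ->
  adj u h1 -> adj v h2 -> adj u x -> adj v x -> A = A1 ++ x :: A2 ->
  adj x y -> walk y (A2 ++ [:: v]) v ->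
  (forall A' b2, A = b :: A' -> adj b b2 -> walk b2 A' c -> adj b2 h1) ->
  (forall B' d2, B = d :: B' -> adj d d2 -> walk d2 B' a -> adj d2 h2) ->
  ~~ adj y h1 /\ ~~ adj y h2.
Proof.
move=> h u1 v2 ux vx eA xy wy hb hd.
have [A' [b2 [eA' bb2 wA']]] := walk_second (let: And4 w _ _ _ := h in w)
  (arc_size hS h (l2 u1 v2)).
have v2' := linked_sym (l2 u1 v2).
have [B' [d2 [eB' dd2 wB']]] := walk_second (let: And4 _ w _ _ := h in w)
  (arc_size hS (arr_swap h) v2').
have b2h := hb _ _ eA' bb2 wA'; have d2h := hd _ _ eB' dd2 wB'.
case: (h) => wA wB [ub cv vd au] p; split; apply/negP=> yh.
  have [wux _] : walk u (rcons (u :: A1) x) x /\ walk x (x :: A2) c.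
    by apply: walk_splitI; rewrite /= -eA; exact: walk_cons wA.
  apply: (reroute hS (linked_sym (l2 yh d2h)) _
    (q := B' ++ rcons (u :: A1) x ++ rev (A2 ++ [:: v])) (r := [:: d])) => //.
  - by apply: contraTneq d2h => ->; exact: not_both.
  - apply: walk_cat wB' au (walk_cat wux _ (walk_rev wy)); by rewrite adjC.
  - by rewrite eA eB' in p; perm_tac p.
case: A1 eA => [|b' A1] eA.
  have [ex eA2] : b = x /\ A' = A2 by case: (etrans (esym eA') eA).
  have e : b2 = y by apply: (walk_head_eq wA' wy (t := [:: v])); rewrite eA2.
  by have := not_both b2h; rewrite e yh.
have eA1 : A' = A1 ++ x :: A2 by case: (etrans (esym eA') eA).
rewrite eA1 in wA'; have [wb2x _] := walk_splitI wA'.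
apply: (reroute hS (l2 b2h yh) _
  (q := rcons A1 x ++ u :: rev B ++ rev (A2 ++ [:: v])) (r := [:: b])) => //.
- by apply: contraTneq yh => <-; exact: not_both.
- apply: walk_cat wb2x _ (walk_cons _ (walk_cat (walk_rev wB) _ (walk_rev wy)));
  by rewrite adjC.
- by rewrite eA' eA1 in p; perm_tac p.
Qed.

Lemma adjacent_second u A v B b c d a A' b2 : arr C u A v B b c d a ->
  adj u h1 -> adj v h2 -> adj u v -> A = b :: A' -> adj b b2 ->
  walk b2 A' c -> adj b2 h1.
Proof.
move=> h u1 v2 uv eA bb2 wA'; apply/negPn/negP=> n1.
have n2 := second_not2 h u1 eA wA'; have nd := second_far h u1 v2 eA wA'.
have [nb _ ndd _] := arr_natts' h u1 v2; case: (h) => _ _ [ub _ vd _] _.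
have bd := arr_bd hS (att1 (arr1 h) u1) (att2 (arr2 h) v2) h.
have vb2 : adj v b2.
  apply/negPn/negP=> vb2; apply: (spider u1 uv ub vd bb2) => //.
  - exact: natt_adj' ndd h1H.
  - by rewrite adjC.
  - by rewrite adjC.
  - by rewrite adjC.
have b2b : adj b2 b by rewrite adjC.
apply: (spider vd vb2 v2 b2b h21) => //.
- by rewrite adjC.
- exact: natt_adj ndd h1H.
- exact: natt_adj nb h2H.
- exact: natt_adj nb h1H.
Qed.

(* Every second vertex after [u] on the cycle sees [h1], up to a neighbour of
   [v]. *)
Lemma alternate_false u v : u \in C -> v \in C -> adj u h1 -> adj v h2 ->
  (forall x, x \in C -> adj x h1 -> exists y, [/\ y \in C, adj y h2 & adj x y]) ->
  False.
Proof.
move=> uC vC u1 v2 all1.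
have au := att1 uC u1; have av := att2 vC v2.
have uv : u != v by apply: contraTneq v2 => <-; exact: not_both.
have [A [B [b [c [d [a]]]]]] := arr_exists hS au av uv.
have [n] := ubnP (size A); elim: n => // n IH in u A B b c d a u1 uC au {uv} *.
move=> sA h; case: (h) => wA wB [ub cv vd au'] p.
have [A' [b2 [eA bb2 wA']]] := walk_second wA (arc_size hS h (l2 u1 v2)).
have b21 : adj b2 h1.
  have [w [wC w2 uw]] := all1 u uC u1.
  have wS : w \in A ++ v :: B.
    have := wC; rewrite -(perm_mem p) inE => /orP[/eqP e|//].
    by rewrite e adjxx in uw.
  have [A0 [B0 eS]] : exists A0 B0, A ++ v :: B = A0 ++ w :: B0.
    by case/splitPr: wS => A0 B0; exists A0, B0.
  have p0 : perm_eq (u :: A0 ++ w :: B0) C by rewrite -eS.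
  have cy : cycle (@adj G) (u :: A0 ++ w :: B0).
    rewrite -eS; apply: (@walk_cycle _ u _ a) => //.
    exact: walk_cons ub (walk_cat wA cv (walk_cons vd wB)).
  have [b' [c' [d' [a' h']]]] := arr_intro hS au (att2 wC w2) cy p0.
  case: (h') => wA0 _ _ _.
  have [A0' [b2' [eA0 bb2' wA0']]] := walk_second wA0 (arc_size hS h' (l2 u1 w2)).
  have -> : b2 = b2'.
    move: eS; rewrite eA eA0.
    have /walkE[s1 -> _] := wA'; have /walkE[s2 -> _] := wA0'.
    by case=> _ -> _.
  exact: adjacent_second h' u1 w2 uw eA0 bb2' wA0'.
have b2C : b2 \in C.
  by rewrite -(perm_mem p) eA !inE mem_cat (walk_mem_head wA') !orbT.
have /walkE[A2 eA2 _] := wA'; rewrite eA2 in eA wA'.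
have ab2 := att1 b2C b21.
have p2 : perm_eq (b2 :: A2 ++ v :: B ++ [:: u; b]) C by rewrite eA in p; perm_tac p.
have cy2 : cycle (@adj G) (b2 :: A2 ++ v :: B ++ [:: u; b]).
  apply: (@walk_cycle _ b2 _ b) => //; rewrite -cat_cons.
  apply: walk_cat wA' cv (walk_cons vd (walk_cat wB au' _)).
  exact: walk_cons ub (walk1 b).
have [b' [c' [d' [a' h']]]] := arr_intro hS ab2 av cy2 p2.
by apply: IH h' => //; rewrite eA /= in sA; exact: ltnW.
Qed.

End Oriented.
Let cardG : 2 < #|G|.
Proof.
by apply: leq_trans (sizeC hS) _; rewrite -(card_uniqP (uniqC hS)) max_card.
Qed.

Lemma common_false h1 h2 u v x : h1 \in H -> h2 \in H -> adj h1 h2 ->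
  u \in C -> v \in C -> x \in C -> adj u h1 -> adj v h2 -> adj u x ->
  adj v x -> False.
Proof.
move=> h1H h2H h12 uC vC xC u1 v2 ux vx.
have h21 : adj h2 h1 by rewrite adjC.
have au := att_intro uC h1H u1; have av := att_intro vC h2H v2.
suff main A B b c d a : arr C u A v B b c d a -> x \notin A.
  have uv : u != v by apply: contraTneq v2 => <-; exact: not_both u1.
  have [A [B [b [c [d [a h]]]]]] := arr_exists hS au av uv.
  move: xC; rewrite (arr_mem x h) inE mem_cat inE.
  rewrite (negbTE (main _ _ _ _ _ _ h)).
  have := main _ _ _ _ _ _ (arr_rev h); rewrite mem_rev => /negbTE->.
  by rewrite orbF => /orP[] /eqP e; [move: ux|move: vx]; rewrite e adjxx.
move=> h; apply/negP=> xA; case/splitPr: A / xA h => A1 A2 h.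
have m := arr_swap (arr_rev h).
have hb A' b2 := common_second h1H h2H h12 (A' := A') (b2 := b2) h u1 v2 ux vx.
have hd A' b2 :=
  common_second h2H h1H h21 (A' := A') (b2 := b2) (arr_swap h) v2 u1 vx ux.
have hb' A' b2 := common_second h2H h1H h21 (A' := A') (b2 := b2) m v2 u1 vx ux.
have hd' A' b2 :=
  common_second h1H h2H h12 (A' := A') (b2 := b2) (arr_swap m) u1 v2 ux vx.
have next y : adj x y -> walk y (A2 ++ [:: v]) v -> ~~ adj y h1 /\ ~~ adj y h2.
  by move=> xy wy; exact: (common_next h1H h2H h12 h u1 v2 ux vx (erefl _) xy wy hb hd).
have eA : rev (A1 ++ x :: A2) = rev A2 ++ x :: rev A1.
  by rewrite rev_cat rev_cons cat_rcons.
have prev y : adj x y -> walk y (rev A1 ++ [:: u]) u -> ~~ adj y h2 /\ ~~ adj y h1.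
  by move=> xy wy; exact: (common_next h2H h1H h21 m v2 u1 vx ux eA xy wy hb' hd').
have A20 : A2 != [::].
  apply/eqP=> e; have [||_] := next v; first by rewrite adjC.
    by rewrite e; exact: walk1.
  by rewrite v2.
have A10 : A1 != [::].
  apply/eqP=> e; have [||_] := prev u; first by rewrite adjC.
    by rewrite e; exact: walk1.
  by rewrite u1.
have [na nd] : unattached C H a /\ unattached C H d by have [] := arr_natts hS au av h.
have uv := arr_neq hS h.
case: (h) => wA wB [ub cv vd au'] p.
have [z [x' [w1 zx w2]]] := walk_catI wA A10 isT.
have [ex [[e _]|[y xy w3]]] := walk_consI w2; first by rewrite e in A20.
rewrite -{x'}ex in zx w2 xy.
have [y1 y2] : ~~ adj y h1 /\ ~~ adj y h2.
  by apply: next => //; apply: walk_cat w3 cv (walk1 v).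
have [z2 z1] : ~~ adj z h2 /\ ~~ adj z h1.
  apply: prev; first by rewrite adjC.
  by apply: walk_cat (walk_rev w1) _ (walk1 u); rewrite adjC.
have xh1 : ~~ adj x h1 by apply/negP=> x1; exact: tf ux u1 x1.
have xh2 : ~~ adj x h2 by apply/negP=> x2; exact: tf vx v2 x2.
have ua : adj u a by rewrite adjC.
have ay : adj a y.
  apply/negPn/negP=> ay; apply: (spider ua ux u1 xy h12) => //.
  exact: natt_adj na h2H.
have xz : adj x z by rewrite adjC.
have dz : adj d z.
  apply/negPn/negP=> dz; apply: (spider vd vx v2 xz h21) => //.
  exact: natt_adj nd h1H.
apply: (reroute hS (linked_edge h1H h2H h12 u1 v2) uv
  (q := u :: A1 ++ B ++ A2 ++ [:: v]) (r := [:: x])) => //.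
  apply: walk_cons ub (walk_cat w1 _ (walk_cat wB ay (walk_cat w3 cv (walk1 v)))).
  by rewrite adjC.
by perm_tac p.
Qed.

Lemma edge_false h1 h2 u v : h1 \in H -> h2 \in H -> adj h1 h2 ->
  u \in C -> v \in C -> adj u h1 -> adj v h2 -> False.
Proof.
move=> h1H h2H h12 uC vC u1 v2.
have [/allP alt|] := boolP (all (fun x => adj x h1 ==>
    has (fun y => adj y h2 && adj x y) C) C).
  apply: (alternate_false h1H h2H h12 uC vC u1 v2) => x xC x1.
  have := alt x xC; rewrite x1 => /hasP[y yC /andP[y2 xy]].
  by exists y.
case/allPn=> u0 u0C; rewrite negb_imply => /andP[u01 /hasPn n0].
have n0' y : y \in C -> adj y h2 -> ~~ adj u0 y.
  by move=> yC y2; have := n0 y yC; rewrite y2.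
apply: (@chain_false _ _ _ _ hfree inS hS tf (fun x => adj x h1) v h2 h1 u0 u0) => //.
- exact: att_intro v2.
- by apply/negP=> v1; exact: tf v1 v2 h12.
- by move=> x x1 xC; exact: att_intro x1.
- by rewrite adjC.
- by rewrite adjC.
- by move=> x /andP[_]; rewrite adjC.
- set X := fun x => _; move=> x Xx /orP[] /eqP fx.
    have [_ [y fy yx]] := level_pred fx (ltnW cardG).
    by apply: n0'; [case/andP: Xx | rewrite -(level_eq0 fy) adjC].
  have [_ [y fy yx]] := level_pred fx cardG.
  have [/andP[yC _] [z fz zy]] := level_pred fy (ltnW cardG).
  apply/negP=> u0x; have [xC _] := andP Xx.
  by apply: (common_false h1H h2H h12 u0C yC xC u01 _ u0x yx); rewrite -(level_eq0 fz) adjC.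
- by right; rewrite adjC.
- by move=> x xC x1; exists 2 => //; apply/linked_sym/(linked_edge h1H h2H).
Qed.

Lemma triangle_free_false : False.
Proof.
have [_ _ [_ _ cn] [g1 [g2 [g1H g2H g12]]] an] := hS.
have [u1 [h1 [u1C h1H u1h1 _ _]]] := an g1.
have [w [h [wC hH wh _ hh1]]] := an h1.
have [p [wp up sub]] := cn h1 h h1H hH.
have inH x : x \in p -> x \in H by exact: sub.
case: p wp up {sub} inH => // x p wp; have [ex [[_ e]|[h2 h12 wp2]]] := walk_consI wp.
  by rewrite e eqxx in hh1.
rewrite {}ex {wp}; case: p wp2 => // y p wp2.
have [ey wp3] := walk_consI wp2; rewrite {}ey {wp2} in wp3 *.
move=> up inH; have h2H : h2 \in H by apply: inH; rewrite !inE eqxx orbT.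
have free2 z : z \in C -> ~~ adj h2 z.
  move=> zC; apply/negP=> z2.
  by apply: (edge_false h1H h2H h12 u1C zC u1h1); rewrite adjC.
case: wp3 => [[_ e]|[h3 h23 wp3]].
  by have := free2 _ wC; rewrite -e adjC wh.
have h3p := walk_mem_head wp3.
have h3H : h3 \in H by apply: inH; rewrite !inE h3p !orbT.
have h31 : h3 != h1.
  by apply: contraTneq up => <-; rewrite /= inE h3p orbT.
have h13 : h1 != h3 by rewrite eq_sym.
have cf := @chain_false _ _ _ _ hfree inS hS tf.
have [/hasP[u2 u2C /andP[u2h1 u21]]|/hasPn only1] :=
    boolP (has (fun x => adj x h1 && (x != u1)) C); last first.
  have [w' [h' [w'C h'H w'h' w'u1 _]]] := an u1.
  have h1h' : h1 != h'.
    by apply: contraTneq w'h' => <-; have := only1 _ w'C; rewrite w'u1 andbT.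
  apply: (cf (pred1 w') u1 u1 h1 h2 w') => //=.
  - exact: att_intro u1h1.
  - by rewrite eq_sym.
  - by move=> _ /eqP-> _; exact: att_intro w'h'.
  - by move=> z /andP[zC _] zu; have := only1 _ zC; rewrite zu andbT adjC.
  - by move=> z /andP[zC _] _; exact: free2.
  - by left.
  - move=> _ _ /eqP->.
    by have [q q1 l] := linkedSS hS h1H h'H h1h' u1h1 w'h'; exists q.
have [/hasP[u0 u0C /andP[u0h1 u0h3]]|/hasPn none] :=
    boolP (has (fun x => adj x h1 && adj x h3) C).
  have [w' [w'C w'h1 w'u0]] : exists w', [/\ w' \in C, adj w' h1 & w' != u0].
    have [e|] := eqVneq u1 u0; last by exists u1.
    by exists u2; rewrite -e.
  apply: (cf (fun x => adj x h1 && (x != u0)) u0 u0 h1 h2 w') => //.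
  - exact: att_intro u0h1.
  - by rewrite eqxx andbF.
  - by rewrite w'h1.
  - by move=> z /andP[z1 _] zC; exact: att_intro z1.
  - by move=> z /andP[zC]; rewrite negb_and negbK adjC => /orP[//|/eqP->]; rewrite eqxx.
  - by move=> z /andP[zC _] _; exact: free2.
  - by left.
  - move=> z _ /andP[z1 _].
    by have [q q1 l] := linkedSS hS h3H h1H h31 u0h3 z1; exists q.
have [/hasP[v vC vh3]|/hasPn none3] := boolP (has (fun x => adj x h3) C).
  apply: (cf (fun x => adj x h3) u1 h1 h2 h3 v) => //.
  - exact: att_intro u1h1.
  - by have := none _ u1C; rewrite u1h1.
  - by move=> z z3 zC; exact: att_intro z3.
  - by move=> z /andP[zC _] _; exact: free2.
  - by move=> z /andP[_]; rewrite adjC.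
  - by right; rewrite adjC.
  - move=> z _ z3.
    by have [q q1 l] := linkedSS hS h1H h3H h13 u1h1 z3; exists q.
have [u [uC uh1 uw]] : exists u, [/\ u \in C, adj u h1 & u != w].
  have [e|] := eqVneq u1 w; last by exists u1.
  by exists u2; rewrite -e.
apply: (cf (pred1 w) u h1 h2 h3 w) => //=.
- exact: att_intro uh1.
- by move=> _ /eqP-> _; exact: att_intro wh.
- by move=> z /andP[zC _] _; exact: free2.
- by move=> z /andP[zC _] _; rewrite adjC; exact: none3.
- by right; rewrite adjC.
- move=> _ _ /eqP->; rewrite eq_sym in hh1.
  by have [q q1 l] := linkedSS hS h1H hH hh1 uh1 wh; exists q.
Qed.

End Edge.

(** * Claw-free graphs *)

Section ClawFree.
Variables (Hs : seq sgraph) (G : sgraph) (C : seq G) (H : {set G}).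
Hypothesis hfree : free Hs G.
Hypothesis inC : List.In claw Hs.
Hypothesis hS : outer_component C H.
Implicit Types (u v w x y z h r t : G) (A B M R s q : seq G).

Local Notation att := (attached C H).
Local Notation natt := (unattached C H).

Let claw u x y z : adj u x -> adj u y -> adj u z -> x != y -> x != z ->
  y != z -> ~~ adj x y -> ~~ adj x z -> adj y z.
Proof.
move=> ux uy uz xy xz yz nxy nxz; apply/negPn/negP=> nyz.
exact: (claw_free hfree inC ux uy uz xy xz yz nxy nxz nyz).
Qed.

Let neqCH x h : x \in C -> h \in H -> h != x.
Proof. by move=> xC hH; apply: contraTneq xC => <-; have := notinC hS hH. Qed.

Lemma natt_clique u x y : att u -> natt x -> natt y -> adj u x -> adj u y ->
  x != y -> adj x y.
Proof.
move=> au nx ny ux uy xy; have /attP[_ [h hH uh]] := au.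
apply: (claw uh ux uy) => //; try exact: (natt_adj' (C := C) (H := H)).
  exact: neqCH (nattC nx) hH.
exact: neqCH (nattC ny) hH.
Qed.

Lemma att_clique u h h' : att u -> h \in H -> h' \in H -> adj u h ->
  adj u h' -> h != h' -> adj h h'.
Proof.
move=> au hH h'H uh uh' hh'; have [b ub nb] := att_nbr hS au.
apply: (claw ub uh uh') => //; try exact: (natt_adj (C := C) (H := H)).
  by rewrite eq_sym; exact: neqCH (nattC nb) hH.
by rewrite eq_sym; exact: neqCH (nattC nb) h'H.
Qed.

Lemma arr_ab u A w B b c d a : att u -> att w -> arr C u A w B b c d a ->
  adj a b.
Proof.
move=> au aw h; have [nb _ _ na] := arr_natts hS au aw h.
have un := arr_uniq hS h; case: h => wA wB [ub _ _ au'] _.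
apply: (natt_clique au na nb _ ub); first by rewrite adjC.
move: un; rewrite /= cat_uniq /= => /and5P[_ _ /norP[_ /hasPn d1] _ _].
by apply: contraNneq (d1 _ (walk_mem_last wB)) => ->; exact: walk_mem_head wA.
Qed.

Lemma arr_cd u A w B b c d a : att u -> att w -> arr C u A w B b c d a ->
  adj c d.
Proof. by move=> au aw /arr_swap; exact: arr_ab. Qed.

Lemma arr_bw u A w B b c d a : att u -> att w -> arr C u A w B b c d a ->
  ~~ adj b w.
Proof.
move=> au aw h; have cd := arr_cd au aw h; have uw := arr_neq hS h.
case: h => wA wB [ub cw wd au'] p; apply/negP=> bw.
apply: (reroute_all hS au aw uw (q := u :: rev B ++ rev A ++ [:: w])).
  apply: walk_cons (walk_cat (walk_rev wB) _ (walk_cat (walk_rev wA) bw (walk1 w)));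
    by rewrite adjC.
by perm_tac p.
Qed.

Lemma arr_ends u A w B b c d a : att u -> att w -> arr C u A w B b c d a ->
  [/\ ~~ adj b w, ~~ adj u c, ~~ adj u d & ~~ adj a w].
Proof.
move=> au aw h; split.
- exact: arr_bw h.
- by rewrite adjC; exact: arr_bw (arr_swap (arr_rev h)).
- by rewrite adjC; exact: arr_bw (arr_swap h).
- exact: arr_bw (arr_rev h).
Qed.

Lemma arr_move u A w B b c d a z : att u -> att w -> arr C u A w B b c d a ->
  natt z -> adj u z -> exists A' B' d' x,
  arr C u A' w B' z c d' x \/ arr C u A' w B' x c d' z.
Proof.
move=> au aw h nz uz; have ab := arr_ab au aw h.
have [nb nc nd na] := arr_natts hS au aw h.
have [bw uc ud aw'] := arr_ends au aw h.
have un := arr_uniq hS h.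
have [zb|zb] := eqVneq z b; first by exists A, B, d, a; left; rewrite zb.
have [za|za] := eqVneq z a; first by exists A, B, d, b; right; rewrite za.
have zc : z != c by apply: contraTneq uz => ->.
have zd : z != d by apply: contraTneq uz => ->.
case: (h) => wA wB [ub cw wd au'] p.
have zb' : adj z b by exact: natt_clique au nz nb uz ub zb.
have split3 A0 b0 c0 : walk b0 A0 c0 -> z \in A0 -> z != b0 -> z != c0 ->
    uniq (u :: A0) ->
    exists A1 A2 x y, [/\ A0 = A1 ++ z :: A2, walk b0 A1 x, walk y A2 c0 &
      [/\ adj x z, adj z y & [\/ adj x y, adj u x | adj u y]]].
  move=> w0 zA zb0 zc0 un0; case/splitPr: A0 / zA w0 un0 => A1 A2 w0 un0.
  have A10 : A1 != [::].
    apply: contraNneq zb0 => e; rewrite e in w0.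
    by have [-> _] := walk_consI w0.
  have [x [z' [w1 xz' w2]]] := walk_catI w0 A10 isT.
  have [ez [[_ e]|[y zy w3]]] := walk_consI w2; first by rewrite ez e eqxx in zc0.
  rewrite -ez in xz' zy; exists A1, A2, x, y; split=> //; split=> //.
  have x1 := walk_mem_last w1; have y2 := walk_mem_head w3.
  have [xu yu xy] : [/\ x != u, y != u & x != y].
    move: un0; rewrite /= mem_cat inE !negb_or cat_uniq /= negb_or.
    case/andP=> /and3P[u1 _ u2] /and4P[_ /andP[_ /hasPn d12] _ _].
    split; [by apply: contraNneq u1 => <-|by apply: contraNneq u2 => <-|].
    by apply: contraNneq (d12 _ y2) => <-.
  have [ux|ux] := boolP (adj u x); first by apply: Or32.
  have [uy|uy] := boolP (adj u y); first by apply: Or33.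
  apply: Or31; apply: (claw (u := z) (x := u)) => //; first [by rewrite adjC | by rewrite eq_sym].
have zm : z \in A \/ z \in B.
  apply/orP; have := nattC nz; rewrite (arr_mem z h) inE mem_cat inE.
  have -> : (z == u) = false by apply: contraTF uz => /eqP->; rewrite adjxx.
  have -> : (z == w) = false by apply: contraTF nz => /eqP->; rewrite /unattached aw andbF.
  by [].
have unA : uniq (u :: A) by move: un; rewrite -cat_cons cat_uniq => /and3P[].
have unB : uniq (u :: B).
  move: un; rewrite -cat_rcons /= mem_cat mem_rcons cat_uniq !negb_or.
  by case/andP=> /andP[_ ->] /and3P[].
case: zm => zm.
  have [A1 [A2 [x [y [eA w1 w2 [xz zy alt]]]]]] := split3 _ _ _ wA zm zb zc unA.
  have zx : adj z x by rewrite adjC.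
  case: alt => alt.
  - exists (z :: A1 ++ A2), B, d, a; left; split=> //.
      by apply: walk_cons zb' (walk_cat w1 alt w2).
    by rewrite eA in p; perm_tac p.
  - exists (z :: A2), (B ++ A1), d, x; left; split.
    + exact: walk_cons zy w2.
    + exact: walk_cat wB ab w1.
    + by split=> //; rewrite adjC.
    + by rewrite eA in p; perm_tac p.
  - exists A2, (B ++ A1 ++ [:: z]), d, y; right; split=> //.
    + by apply: walk_cat wB ab (walk_cat w1 xz (walk1 z)).
    + by split=> //; rewrite adjC.
    + by rewrite eA in p; perm_tac p.
have [B1 [B2 [x [y [eB w1 w2 [xz zy alt]]]]]] := split3 _ _ _ wB zm zd za unB.
case: alt => alt.
- exists (z :: A), (B1 ++ B2), d, a; left; split=> //.
  + exact: walk_cons zb' wA.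
  + exact: walk_cat w1 alt w2.
  + by rewrite eB in p; perm_tac p.
- exists (z :: B2 ++ A), B1, d, x; left; split=> //.
  + exact: walk_cons zy (walk_cat w2 ab wA).
  + by split=> //; rewrite adjC.
  + by rewrite eB in p; perm_tac p.
- exists (B2 ++ A), (B1 ++ [:: z]), d, y; right; split.
  + exact: walk_cat w2 ab wA.
  + exact: walk_cat w1 xz (walk1 z).
  + by split=> //; rewrite adjC.
  + by rewrite eB in p; perm_tac p.
Qed.

Lemma natt_disjoint u w z : att u -> att w -> u != w -> natt z -> adj u z ->
  ~~ adj w z.
Proof.
move=> au aw uw nz uz; have [A [B [b [c [d [a h]]]]]] := arr_exists hS au aw uw.
have [A' [B' [d' [x [h'|h']]]]] := arr_move au aw h nz uz.
  by rewrite adjC; have [] := arr_ends au aw h'.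
by rewrite adjC; have [] := arr_ends au aw h'.
Qed.

Lemma arr_settle u A w B b c d a : att u -> att w -> arr C u A w B b c d a ->
  exists A' B' c' d1 d2, [/\ arr C u A' w (d1 :: B') b c' d1 a,
    walk d2 B' a, adj d1 d2 & ~~ adj w d2].
Proof.
move=> au aw; have [n] := ubnP (size B); elim: n => // n IH in A B c d *.
move=> sB h; have cd := arr_cd au aw h; have [_ _ ud _] := arr_ends au aw h.
case: (h) => wA wB [ub cw wd au'] p; case: B wB sB h p => // d0 B wB sB h p.
have [ed0 [[_ e]|[d2 dd2 wB']]] := walk_consI wB.
  by rewrite e adjC (negbTE ud) in au'.
rewrite {d0}ed0 in wB h p sB; have [wd2|wd2] := boolP (adj w d2); last first.
  by exists A, B, c, d, d2.
apply: (IH (rcons A d) B d d2) => //; split=> //.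
- exact: walk_rcons wA cd.
- by split=> //; rewrite adjC.
- by perm_tac p.
Qed.

Lemma settled_far u A w B b c d a d2 : att u -> att w ->
  arr C u A w (d :: B) b c d a -> walk d2 B a -> adj d d2 -> ~~ adj w d2 ->
  [/\ natt d2, ~~ adj u d2 & ~~ adj b d2].
Proof.
move=> au aw h wB2 dd2 wd2.
have [_ _ nd _] := arr_natts hS au aw h; have ab := arr_ab au aw h.
have cd := arr_cd au aw h; have uw := arr_neq hS h.
have un := arr_uniq hS h; case: (h) => wA _ [ub cw wd au'] p.
have d2B := walk_mem_head wB2.
split.
- have d2C : d2 \in C by rewrite (arr_mem d2 h) !inE mem_cat !inE d2B !orbT.
  rewrite /unattached d2C; apply/negP=> ad2.
  have wd2' : w != d2.
    have : w \notin d :: B.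
      by move: un; rewrite -cat_cons cat_uniq => /and3P[_ _ /andP[]].
    by apply: contraNneq => ->; rewrite inE d2B orbT.
  have := natt_disjoint aw ad2 wd2' nd wd; by rewrite adjC dd2.
- apply/negP=> ud2; apply: (reroute_all hS au aw uw
    (q := u :: B ++ A ++ [:: d; w])).
    apply: walk_cons ud2 (walk_cat wB2 ab (walk_cat wA cd (walk_cons _ (walk1 w)))).
    by rewrite adjC.
  by perm_tac p.
- apply/negP=> bd2; apply: (reroute_all hS au aw uw
    (q := u :: rev B ++ A ++ [:: d; w])).
    apply: walk_cons (walk_cat (walk_rev wB2) _ (walk_cat wA cd
      (walk_cons _ (walk1 w)))); by rewrite adjC.
  by perm_tac p.
Qed.

Section Levels.
Variables (X : pred G) (r t : G).
Local Notation f := (level X r).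
Hypothesis rt : adj r t.
Hypothesis Xt : forall x, X x -> x != r -> ~~ adj t x.
Hypothesis X1 : forall x y, f x = 1 -> f y = 1 -> x != y -> adj x y.
Hypothesis X2 : forall a b x y, f a = 1 -> f b = 1 -> f x = 2 -> f y = 2 ->
  X a -> X b -> X x -> X y ->
  adj r a -> adj r b -> adj a b -> adj b x -> adj a y -> ~~ adj a x ->
  ~~ adj b y -> ~~ adj x y -> False.
Hypothesis net : forall z' z w a b x y : G, adj z' z -> adj z w -> adj w a -> adj w b ->
  adj a b -> adj b x -> adj a y ->
  ~~ adj z' w -> ~~ adj z' a -> ~~ adj z' b -> ~~ adj z' x -> ~~ adj z' y ->
  ~~ adj z a -> ~~ adj z b -> ~~ adj z x -> ~~ adj z y ->
  ~~ adj w x -> ~~ adj w y -> ~~ adj a x -> ~~ adj b y -> ~~ adj x y -> False.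

Lemma level_clique n x y : f x = n.+1 -> f y = n.+1 -> n.+1 < #|G| -> x != y ->
  adj x y.
Proof.
elim: n x y => [|n IH] x y fx fy lt xy; first exact: X1.
have ltn := ltnW lt.
have [Xx [b fb bx]] := level_pred fx lt; have [Xy [a fa ay]] := level_pred fy lt.
have [Xb [w fw wb]] := level_pred fb ltn.
apply/negPn/negP=> nxy.
have far m m' z z' : f z = m -> f z' = m' -> m.+1 < m' -> m < #|G| -> X z' ->
    ~~ adj z z'.
  by move=> fz fz' mm mG Xz'; apply: (@level_far _ X r) => //; rewrite ?fz ?fz'.
have bw : adj b w by rewrite adjC.
have nG : n < #|G| by apply: ltnW.
have [wx wy] : ~~ adj w x /\ ~~ adj w y.
  by split; [apply: (far _ _ _ _ fw fx)|apply: (far _ _ _ _ fw fy)].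
have neq z z' m m' : f z = m -> f z' = m' -> m != m' -> z != z'.
  by move=> fz fz'; apply: contraNneq => e; rewrite -fz -fz' e.
have wx' : w != x by apply: (neq _ _ _ _ fw fx); clear; lia.
have wy' : w != y by apply: (neq _ _ _ _ fw fy); clear; lia.
have ny : ~~ adj b y.
  by apply/negP=> nby; case/negP: nxy; exact: (claw bw bx nby).
have ab : a != b by apply: contraNneq ny => <-.
have nx : ~~ adj a x.
  have [Xa [w' fw' wa']] := level_pred fa ltn.
  apply/negP=> ax; case/negP: nxy; apply: (claw (x := w') _ ax ay) => //.
  - by rewrite adjC.
  - by apply: (neq _ _ _ _ fw' fx); clear; lia.
  - by apply: (neq _ _ _ _ fw' fy); clear; lia.
  - by apply: (far _ _ _ _ fw' fx).
  - by apply: (far _ _ _ _ fw' fy).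
have abA : adj a b by exact: IH.
have ba : adj b a by rewrite adjC.
have [Xa _] := level_pred fa ltn.
have wa' : w != a by apply: (neq _ _ _ _ fw fa); clear; lia.
have xa : x != a by apply: (neq _ _ _ _ fx fa); clear; lia.
(* The claw at [b] turns a parent of [b] into a common parent of [a] and [b]. *)
have wa : adj w a.
  apply: (claw bx bw ba) => //; by [rewrite eq_sym | rewrite adjC].
case: n IH lt ltn nG fx fy fa fb fw => [|n] IH lt ltn nG fx fy fa fb fw.
  by rewrite (level_eq0 fw) in wa wb; exact: (X2 fa fb fx fy).
have [Xw [z fz zw]] := level_pred fw nG.
have [za zb] : ~~ adj z a /\ ~~ adj z b.
  by split; [apply: (far _ _ _ _ fz fa)|apply: (far _ _ _ _ fz fb)] => //; exact: ltnW.
have nG' : n < #|G| by exact: ltnW.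
have [zx zy] : ~~ adj z x /\ ~~ adj z y.
  by split; [apply: (far _ _ _ _ fz fx)|apply: (far _ _ _ _ fz fy)].
have nr v m : level X r v = m.+1 -> v != r.
  by move=> e; apply/eqP=> vr; rewrite vr level_root in e.
case: n IH lt ltn nG nG' fx fy fa fb fw fz => [|n] IH lt ltn nG nG' fx fy fa fb fw fz.
  have ez := level_eq0 fz; rewrite {z fz}ez in zw za zb zx zy.
  have tr : adj t r by rewrite adjC.
  apply: (net tr zw wa wb abA bx ay) => //; apply: Xt => //;
  first [exact: nr fw|exact: nr fa|exact: nr fb|exact: nr fx|exact: nr fy].
have [_ [z' fz' zz']] := level_pred fz nG'.
apply: (net zz' zw wa wb abA bx ay) => //.
- by apply: (far _ _ _ _ fz' fw) => //; exact: ltnW.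
- by apply: (far _ _ _ _ fz' fa) => //; exact: ltnW.
- by apply: (far _ _ _ _ fz' fb) => //; exact: ltnW.
- by apply: (far _ _ _ _ fz' fx) => //; exact: ltnW.
- by apply: (far _ _ _ _ fz' fy) => //; exact: ltnW.
Qed.

End Levels.
Section Root.
Variable u : G.
Hypothesis au : att u.
Let X x : bool := (x == u) || natt x.
Local Notation f := (level X u).

Let natt_X x : X x -> x != u -> natt x.
Proof. by rewrite /X => /orP[/eqP->|//]; rewrite eqxx. Qed.

Let X_natt x n : f x = n.+1 -> n.+1 < #|G| -> natt x.
Proof.
move=> e lt; have [Xx _] := level_pred e lt; apply: natt_X Xx _.
by apply/eqP=> xu; rewrite xu level_root in e.
Qed.

Let level1 x : f x = 1 -> adj u x /\ natt x.
Proof.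
move=> e; have lt : 1 < #|G|.
  apply: leq_ltn_trans (_ : 1 <= 2) _ => //; apply: leq_trans (sizeC hS) _.
  by rewrite -(card_uniqP (uniqC hS)) max_card.
split; last exact: X_natt e lt.
by have [_ [v fv vx]] := level_pred e lt; rewrite -(level_eq0 fv).
Qed.

Lemma level_cliques_false :
  (forall n x y, f x = n.+1 -> f y = n.+1 -> n.+1 < #|G| -> x != y -> adj x y) ->
  False.
Proof.
move=> hcl; have [_ _ _ _ /(_ u)[w [h [wC hH wh wu _]]]] := hS.
have Ww : att w && (w != u) by rewrite wu (att_intro wC hH wh).
have nWu : ~~ (att u && (u != u)) by rewrite eqxx andbF.
have Watt x : att x && (x != u) -> x \in C -> att x by case/andP.
have [A [M [R [b [c [w1 [w2 [e [a]]]]]]]]] :=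
  two_sided (W := fun x => att x && (x != u)) hS au nWu wC Ww Watt.
case=> p [wA wM wR] [ub cw ew ua] [Ww1 Ww2 w1C w2C] [nb nc ne na nAR].
have un : uniq (u :: A ++ M ++ R) by rewrite (perm_uniq p) (uniqC hS).
have nt x : x \in A ++ R -> natt x /\ x != u.
  move=> xAR; have xC : x \in C.
    rewrite -(perm_mem p) inE !mem_cat; move: xAR; rewrite mem_cat.
    by case/orP=> ->; rewrite ?orbT.
  have xu : x != u.
    move: un xAR => /= /andP[+ _]; rewrite !mem_cat => uA xA.
    by apply: contraNneq uA => <-; case/orP: xA => ->; rewrite ?orbT.
  by split=> //; have := nAR x xAR; rewrite /unattached xC xu andbT.
have XAR x : x \in A ++ R -> X x by case/nt=> nx _; rewrite /X nx orbT.
have Xu : X u by rewrite /X eqxx.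
have fuG : f u < #|G| by rewrite level_root; apply/card_gt0P; exists u.
have reach s x y : walk x s y -> adj u x -> {subset s <= A ++ R} ->
    forall z, z \in s -> f z < #|G|.
  move=> ws ux sub z zs; case/splitPr: s / zs ws sub => s1 s2 ws sub.
  have [wz _] := walk_splitI ws.
  apply: (@level_walk _ X u u (u :: rcons s1 z)) => //; first exact: walk_cons ux wz.
  rewrite /= Xu; apply/allP=> v; rewrite mem_rcons inE => vs.
  by apply/XAR/sub; rewrite mem_cat inE orbCA; case/orP: vs => ->; rewrite ?orbT.
have sA : {subset A <= A ++ R} by move=> z; rewrite mem_cat => ->.
have sR : {subset R <= A ++ R} by move=> z; rewrite mem_cat => ->; rewrite orbT.
have fG x : x \in A ++ R -> f x < #|G|.
  by rewrite mem_cat => /orP[]; [exact: reach wA ub sA x|exact: reach wR ua sR x].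
have f0 x : x \in A ++ R -> 0 < f x by case/nt=> _; exact: level_gt0.
have fst1 x y : x \in A ++ R -> y \in A ++ R -> adj x y -> f y <= (f x).+1.
  by move=> xm ym xy; have [] := level_step xy (XAR _ ym) (fG _ xm).
have f1 x : x \in A ++ R -> adj u x -> f x <= 1.
  by move=> xm ux; have [] := level_step ux (XAR _ xm) fuG; rewrite level_root.
have fcl x y : x \in A ++ R -> y \in A ++ R -> x != y -> f x = f y -> adj x y.
  move=> xm ym xy e'; have fx := f0 _ xm; apply: (hcl (f x).-1) => //;
  by rewrite prednK // fG.
have bA := sA _ (walk_mem_head wA); have aR := sR _ (walk_mem_head wR).
have aw1 := Watt _ Ww1 w1C; have aw2 := Watt _ Ww2 w2C.
have fu := level_root X u.
have [le|/ltnW le] := leqP (f c) (f e).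
  exact: (clique_ladder_false hS p wA wM wR ub ew ua fu le fst1 f0
    (f1 _ bA ub) (f1 _ aR ua) fcl au aw1).
have sw x : (x \in R ++ A) = (x \in A ++ R) by rewrite !mem_cat orbC.
have p' : perm_eq (u :: R ++ rev M ++ A) C by perm_tac p.
apply: (clique_ladder_false hS p' wR (walk_rev wM) wA ua cw ub fu le _ _
  (f1 _ aR ua) (f1 _ bA ub) _ au aw2).
- by move=> x y; rewrite !sw; exact: fst1.
- by move=> x; rewrite sw; exact: f0.
- by move=> x y; rewrite !sw; exact: fcl.
Qed.

Lemma root_net_false t : t \in H -> adj u t ->
  (forall a b x y, natt a -> natt b -> natt x -> natt y ->
     adj u a -> adj u b -> adj a b -> adj b x -> adj a y ->
     ~~ adj u x -> ~~ adj u y -> ~~ adj a x -> ~~ adj b y -> ~~ adj x y -> False) ->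
  (forall z' z w a b x y : G, adj z' z -> adj z w -> adj w a -> adj w b ->
     adj a b -> adj b x -> adj a y ->
     ~~ adj z' w -> ~~ adj z' a -> ~~ adj z' b -> ~~ adj z' x -> ~~ adj z' y ->
     ~~ adj z a -> ~~ adj z b -> ~~ adj z x -> ~~ adj z y ->
     ~~ adj w x -> ~~ adj w y -> ~~ adj a x -> ~~ adj b y -> ~~ adj x y ->
     False) -> False.
Proof.
move=> tH ut root net; apply: level_cliques_false.
have cG : 2 < #|G|.
  apply: leq_trans (sizeC hS) _.
  by rewrite -(card_uniqP (uniqC hS)) max_card.
have u2 x : f x = 2 -> X x -> ~~ adj u x.
  move=> fx Xx; apply: (@level_far _ X u) => //; rewrite ?level_root ?fx //.
  exact: ltnW (ltnW cG).
apply: (level_clique ut) => //.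
- by move=> x Xx xu; exact: natt_adj' (natt_X Xx xu) tH.
- move=> x y /level1[ux nx] /level1[uy ny] xy.
  exact: natt_clique au nx ny ux uy xy.
move=> a b x y fa fb fx fy Xa Xb Xx Xy ua ub ab bx ay nax nby nxy.
have [_ na] := level1 fa; have [_ nb] := level1 fb.
apply: (root a b x y) => //; try exact: u2.
  exact: X_natt fx cG.
exact: X_natt fy cG.
Qed.

End Root.

Lemma net_free_false : List.In (graph_N 1 1 1) Hs -> False.
Proof.
move=> inN; have [_ _ _ [h1 _] /(_ h1)[u [h [uC hH uh _ _]]]] := hS.
apply: (root_net_false (att_intro uC hH uh) hH uh).
  move=> a b x y na nb nx ny ua ub ab bx ay ux uy ax by' xy.
  apply: (net_free hfree (a := u) (b := a) (c := b) (p := h) (q := y) (r := x) inN);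
  adj_auto.
move=> z' z w a b x y *.
by apply: (net_free hfree (a := w) (b := a) (c := b) (p := z) (q := y) (r := x) inN);
  adj_auto.
Qed.

Lemma B12_free_false : List.In (graph_B 1 2) Hs -> False.
Proof.
move=> inB; have [_ _ [_ _ cn] [g1 [_ [g1H _ _]]] an] := hS.
have big z' z w a b x y : adj z' z -> adj z w -> adj w a -> adj w b ->
     adj a b -> adj b x -> adj a y ->
     ~~ adj z' w -> ~~ adj z' a -> ~~ adj z' b -> ~~ adj z' x -> ~~ adj z' y ->
     ~~ adj z a -> ~~ adj z b -> ~~ adj z x -> ~~ adj z y ->
     ~~ adj w x -> ~~ adj w y -> ~~ adj a x -> ~~ adj b y -> ~~ adj x y -> False.
  move=> *; apply: (B12_free hfree (a := w) (b := b) (c := a) (p := x) (q1 := z)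
    (q2 := z') inB); adj_auto.
have full u h : att u -> h \in H -> adj u h.
  move=> au hH; apply/negPn/negP=> uh; have /attP[uC [h0 h0H uh0]] := au.
  have [s [ws _ sub]] := cn h0 h h0H hH.
  have [s1 [s2 [z [z' [es w1 zz' w2 [_ uz uz']]]]]] :=
    walk_cross (P := adj u) ws uh0 uh.
  have zH : z \in H by apply: sub; rewrite es mem_cat (walk_mem_last w1).
  have z'H : z' \in H by apply: sub; rewrite es mem_cat (walk_mem_head w2) orbT.
  apply: (root_net_false au zH uz _ big).
  move=> a b x y na nb nx ny ua ub ab bx ay ux uy ax by' xy.
  apply: (B12_free hfree (a := u) (b := b) (c := a) (p := x) (q1 := z)
    (q2 := z') inB);
  adj_auto.
have [u [h [uC hH uh _ _]]] := an g1.
have [w [h' [wC h'H wh' wu _]]] := an u.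
have au := att_intro uC hH uh; have aw := att_intro wC h'H wh'.
have wh : adj w h by exact: full.
have uw : u != w by rewrite eq_sym.
have [uw'|nuw] := boolP (adj u w).
  have [A0 [B0 [b [c0 [d0 [a h0]]]]]] := arr_exists hS au aw uw.
  have [A [B [c [d [d2 [ha wB2 dd2 wd2]]]]]] := arr_settle au aw h0.
  have [nd2 ud2 bd2] := settled_far au aw ha wB2 dd2 wd2.
  have [nb nc nd na] := arr_natts hS au aw ha.
  have [bw uc ud aw'] := arr_ends au aw ha; have bd := arr_bd hS au aw ha.
  case: ha => _ _ [ub cw wd _] _.
  apply: (B12_free hfree (a := w) (b := u) (c := h) (p := b) (q1 := d)
    (q2 := d2) inB);
  adj_auto.
apply: (root_net_false au hH uh _ big).
have small a b x y : natt a -> natt b -> natt x ->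
   adj u a -> adj u b -> adj a b -> adj b x ->
   ~~ adj u x -> ~~ adj a x -> ~~ adj w x -> False.
  move=> na nb nx ua ub ab bx ux ax wx.
  have wa := natt_disjoint au aw uw na ua; have wb := natt_disjoint au aw uw nb ub.
  apply: (B12_free hfree (a := u) (b := b) (c := a) (p := x) (q1 := h)
    (q2 := w) inB);
  adj_auto.
move=> a b x y na nb nx ny ua ub ab bx ay ux uy ax by' xy.
have [wx|wx] := boolP (adj w x); last exact: (small a b x y).
have [wy|wy] := boolP (adj w y); last first.
  by apply: (small b a y x) => //; rewrite adjC.
case/negP: xy; apply: natt_clique aw nx ny wx wy _.
by apply: contraNneq ax => ->.
Qed.

End ClawFree.

(** * The pair $K_{1,3}$, $Z_4$ *)

Section Z4.
Variables (Hs : seq sgraph) (G : sgraph) (C : seq G) (H : {set G}).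
Hypothesis hfree : free Hs G.
Hypothesis inC : List.In claw Hs.
Hypothesis inZ : List.In (graph_Z 4) Hs.
Hypothesis hS : outer_component C H.
Implicit Types (u v w x y z h g : G) (A B q s : seq G).

Local Notation att := (attached C H).
Local Notation natt := (unattached C H).

Let claw u x y z : adj u x -> adj u y -> adj u z -> x != y -> x != z ->
  y != z -> ~~ adj x y -> ~~ adj x z -> adj y z.
Proof.
move=> ux uy uz xy xz yz nxy nxz; apply/negPn/negP=> nyz.
exact: (claw_free hfree inC ux uy uz xy xz yz nxy nxz nyz).
Qed.

Let neqCH x h : x \in C -> h \in H -> h != x.
Proof. by move=> xC hH; apply: contraTneq xC => <-; have := notinC hS hH. Qed.

Let neq_att x y : att x -> natt y -> x != y.
Proof. by move=> ax ny; apply: contraTneq ny => <-; rewrite /unattached ax andbF. Qed.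

Let arr_disjoint u A w B b c d a x y : arr C u A w B b c d a -> x \in A ->
  y \in B -> x != y.
Proof.
move=> /(arr_uniq hS); rewrite -cat_cons cat_uniq => /and3P[_ /hasPn dis _] xA yB.
have := dis y; rewrite !inE yB orbT => /(_ isT); rewrite negb_or => /andP[_].
by apply: contraNneq => <-.
Qed.

Lemma adj_att_nbrs u w h : att u -> att w -> adj u w -> h \in H -> adj u h ->
  adj w h.
Proof.
move=> au aw uw hH uh; have uw' := adj_neq uw.
have [A [B [b [c [d [a ha]]]]]] := arr_exists hS au aw uw'.
have [nb _ _ _] := arr_natts hS au aw ha.
have [bw _ _ _] := arr_ends hfree inC hS au aw ha.
case: ha => _ _ [ub _ _ _] _.
rewrite adjC; apply: (claw ub uh uw) => //.
- by rewrite eq_sym; exact: neqCH (nattC nb) hH.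
- by rewrite eq_sym; exact: neq_att.
- exact: neqCH (attC aw) hH.
- exact: natt_adj nb hH.
Qed.

Lemma Z4_linked2 u w h1 h2 : att u -> att w -> h1 \in H -> h2 \in H ->
  adj u h1 -> adj h1 h2 -> adj w h2 -> ~~ adj u h2 -> ~~ adj w h1 ->
  ~~ adj u w -> u != w -> False.
Proof.
move=> au aw h1H h2H uh1 h12 wh2 uh2 wh1 nuw uw.
have [A [B [b [c [d [a ha]]]]]] := arr_exists hS au aw uw.
have [nb nc nd na] := arr_natts hS au aw ha.
have [bw uc ud aw'] := arr_ends hfree inC hS au aw ha.
have bd := arr_bd hS au aw ha; have ac := arr_ac hS au aw ha.
have ab := arr_ab hfree inC hS au aw ha; have cd := arr_cd hfree inC hS au aw ha.
have un := arr_uniq hS ha; have l2 := linked_edge h1H h2H h12 uh1 wh2.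
case: (ha) => wA wB [ub cw wd au'] p.
have cb : adj c b.
  apply/negPn/negP=> cb; apply: (Z4_free hfree (a := u) (b := b) (c := a)
    (p1 := h1) (p2 := h2) (p3 := w) (p4 := c) inZ); adj_auto.
have da : adj d a.
  apply/negPn/negP=> da; apply: (Z4_free hfree (a := u) (b := b) (c := a)
    (p1 := h1) (p2 := h2) (p3 := w) (p4 := d) inZ); adj_auto.
have [A' [b2 [eA bb2 wA']]] := walk_second wA (arc_size hS ha l2).
have [I eI] : exists I, A' = rcons I c.
  case/lastP: A' wA' {eA} => // I x wI; exists I.
  by have [-> _] := walk_rconsI wI.
have short q r : walk u q w -> perm_eq (q ++ r) C -> 1 < size r.
  by move=> wq pq; rewrite ltnNge; apply/negP=> sr; exact: (reroute hS l2 uw wq pq).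
have sI : 1 < size I.
  apply: (short (u :: b :: rev B ++ [:: c; w])).
    apply: walk_cons ub (walk_cons _ (walk_cat (walk_rev wB) _
      (walk_cons cw (walk1 w)))); by rewrite adjC.
  by rewrite eA eI in p; perm_tac p.
rewrite eI in wA' eA.
have [_ [[e _]|[c2 c2c wI]]] := walk_rconsI wA'; first by rewrite e in sI.
have b2I := walk_mem_head wI; have c2I := walk_mem_last wI.
have unI : uniq (b :: rcons I c).
  by move: un; rewrite eA -cat_cons cat_uniq => /and3P[/andP[]].
have {unI} [bI cI uI] : [/\ b \notin I, c \notin I & uniq I].
  by move: unI; rewrite /= rcons_uniq mem_rcons inE negb_or => /and3P[/andP[]].
have b2c2 : b2 != c2.
  apply/eqP=> e; case: I sI wI {wA' eA eI b2I c2I bI cI} uI => // x [//|y I] _ wI.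
  have [_ [[//]|[z _ wz]]] := walk_consI wI.
  have [ex _] := walk_consI wI; rewrite {x}ex in wI *.
  by rewrite -e in wz; rewrite /= (walk_mem_last wz).
have b2d : ~~ adj b2 d.
  apply/negP=> b2d; apply: (reroute_all hS au aw uw
    (q := u :: b :: rev B ++ rcons I c ++ [:: w])).
    apply: walk_cons ub (walk_cons _ (walk_cat (walk_rev wB) _
      (walk_cat wA' cw (walk1 w)))); by rewrite adjC.
  by rewrite eA in p; perm_tac p.
have c2a : ~~ adj c2 a.
  apply/negP=> c2a; apply: (reroute_all hS au aw uw
    (q := u :: (b :: I) ++ rev B ++ [:: c; w])).
    apply: walk_cons ub (walk_cat (walk_cons bb2 wI) c2a (walk_cat (walk_rev wB) _
      (walk_cons cw (walk1 w)))); by rewrite adjC.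
  by rewrite eA in p; perm_tac p.
have inCI x : x \in I -> x \in C.
  by move=> xI; rewrite (arr_mem x ha) eA inE mem_cat inE mem_rcons inE xI !orbT.
have wc : adj w c by rewrite adjC.
have nb2 : natt b2.
  rewrite /unattached inCI //; apply/negP=> ab2.
  have ub2 : u != b2.
    move: un => /= /andP[+ _]; apply: contraNneq => ->.
    by rewrite eA mem_cat inE mem_rcons inE b2I !orbT.
  have := natt_disjoint hfree inC hS au ab2 ub2 nb ub.
  by rewrite adjC bb2.
have nc2 : natt c2.
  rewrite /unattached inCI //; apply/negP=> ac2.
  have wc2 : w != c2.
    apply: contraTneq un => ->.
    by rewrite eA /= cat_uniq /= mem_rcons inE c2I !orbT !andbF.
  have := natt_disjoint hfree inC hS aw ac2 wc2 nc wc.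
  by rewrite c2c.
have wb2 : ~~ adj w b2.
  apply/negP=> wb2; case/negP: b2d.
  apply: (natt_clique hfree inC hS aw nb2 nd wb2 wd).
  apply: (arr_disjoint ha _ (walk_mem_head wB)).
  by rewrite eA inE mem_rcons inE b2I !orbT.
have ub2 : ~~ adj u b2.
  apply/negP=> ub2; apply: (Z4_free hfree (a := u) (b := b) (c := b2)
    (p1 := h1) (p2 := h2) (p3 := w) (p4 := d) inZ); adj_auto.
have uc2 : ~~ adj u c2.
  apply/negP=> uc2; case/negP: c2a.
  apply: (natt_clique hfree inC hS au nc2 na uc2 _); first by rewrite adjC.
  apply: (arr_disjoint ha _ (walk_mem_last wB)).
  by rewrite eA inE mem_rcons inE c2I !orbT.
have h21 : adj h2 h1 by rewrite adjC.
have wc2 : ~~ adj w c2.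
  apply/negP=> wc2; apply: (Z4_free hfree (a := w) (b := c) (c := c2)
    (p1 := h2) (p2 := h1) (p3 := u) (p4 := a) inZ); adj_auto.
have bc : adj b c by rewrite adjC.
have bu : adj b u by rewrite adjC.
have cb2 : adj c b2.
  apply: (claw bu bc bb2) => //.
  - exact: neq_att.
  - exact: neq_att.
  - by apply: contraNneq cI => ->.
have cc2 : adj c c2 by rewrite adjC.
have wb : ~~ adj w b by rewrite adjC.
have bc2 : adj b c2.
  apply: (claw cw cb cc2) => //; try exact: neq_att.
  by apply: contraNneq bI => ->.
have b2c2' : adj b2 c2 by apply: (claw cw cb2 cc2) => //; exact: neq_att.
by apply: (Z4_free hfree (a := b) (b := b2) (c := c2)
    (p1 := u) (p2 := h1) (p3 := h2) (p4 := w) inZ); adj_auto.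
Qed.

Lemma level_between (X : pred G) r m x j : level X r x = m -> m < #|G| -> j <= m ->
  exists y, level X r y = j.
Proof.
elim: m x => [|m IH] x fx mG jm.
  by exists x; rewrite fx; apply/esym/eqP; rewrite -leqn0.
move: jm; rewrite leq_eqVlt => /orP[/eqP->|jm]; first by exists x.
have [_ [y fy _]] := level_pred fx mG.
exact: (IH y fy (ltnW mG) jm).
Qed.

Lemma Z4_disjoint u w : att u -> att w -> u != w ->
  (forall h, h \in H -> adj u h -> ~~ adj w h) -> False.
Proof.
move=> au aw uw dis.
have nuw : ~~ adj u w.
  apply/negP=> nuw; have /attP[_ [h hH uh]] := au.
  by have := dis h hH uh; rewrite (adj_att_nbrs au aw nuw hH uh).
have [A [B [b [c [d [a ha]]]]]] := arr_exists hS au aw uw.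
have [nb _ _ na] := arr_natts hS au aw ha.
have [bw uc ud aw'] := arr_ends hfree inC hS au aw ha.
have ab := arr_ab hfree inC hS au aw ha.
have [ub ua] : adj u b /\ adj u a by case: ha => _ _ [ub _ _]; rewrite adjC.
pose X h := h \in H; pose f := level X u.
have fuG : f u < #|G| by rewrite /f level_root; apply/card_gt0P; exists u.
have Z3 h1 h2 h3 h4 : h1 \in H -> h2 \in H -> h3 \in H -> adj u h1 -> adj h1 h2 ->
    adj h2 h3 -> adj h3 h4 -> ~~ adj u h2 -> ~~ adj u h3 -> ~~ adj u h4 ->
    ~~ adj b h4 -> ~~ adj a h4 -> ~~ adj h1 h3 -> ~~ adj h1 h4 -> ~~ adj h2 h4 ->
    False.
  move=> h1H h2H h3H *; apply: (Z4_free hfree (a := u) (b := b) (c := a)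
    (p1 := h1) (p2 := h2) (p3 := h3) (p4 := h4) inZ); adj_auto.
have far m m' x y : f x = m -> f y = m' -> m.+1 < m' -> m < #|G| -> X y -> ~~ adj x y.
  by move=> fx fy mm mG Xy; apply: (@level_far _ X u); rewrite -/f ?fx ?fy.
have [h0 h0H wh0] : exists2 h, h \in H & adj w h by case/attP: aw.
have P0 : (h0 \in H) && adj w h0 by rewrite h0H.
case: (@arg_minnP _ h0 (fun h => (h \in H) && adj w h) f P0) => h /andP[hH wh] hmin.
have fhG : f h < #|G|.
  have /attP[_ [g gH ug]] := au.
  have [_ _ [_ _ /(_ g h gH hH)[s [ws _ sub]]] _ _] := hS.
  have [_ fg] := @level_step _ X u _ _ ug gH fuG.
  by apply: (level_walk ws _ fg); apply/allP.
have uh : ~~ adj u h by apply: contraTN wh => uh; exact: dis.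
have pred1 x n : f x = n.+1 -> n.+1 < #|G| -> x \in H /\ exists2 y, f y = n & adj y x.
  exact: level_pred.
have f1 x : f x = 1 -> 1 < #|G| -> x \in H /\ adj u x.
  by move=> e lt; have [xH [y fy yx]] := pred1 _ _ e lt; rewrite -(level_eq0 fy).
have fu : f u = 0 by exact: level_root.
have [m3|m3] := leqP (f h) 3; last first.
  have [h4 f4] := level_between (erefl (f h)) fhG m3.
  have G4 : 4 < #|G| by exact: leq_ltn_trans m3 fhG.
  have G3 := ltnW G4; have G2 := ltnW G3; have G1 := ltnW G2; have G0 := ltnW G1.
  have [h4H [h3 f3 h34]] := pred1 _ _ f4 G4.
  have [h3H [h2 f2 h23]] := pred1 _ _ f3 G3.
  have [h2H [h1 f1' h12]] := pred1 _ _ f2 G2.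
  have [h1H uh1] := f1 _ f1' G1.
  apply: (Z3 h1 h2 h3 h4) => //; try exact: (natt_adj (C := C) (H := H)).
  - exact: far fu f2 _ _ _.
  - exact: far fu f3 _ _ _.
  - exact: far fu f4 _ _ _.
  - exact: far f1' f3 _ _ _.
  - exact: far f1' f4 _ _ _.
  - exact: far f2 f4 _ _ _.
have [n fh] : exists n, f h = n by exists (f h).
rewrite fh in m3 fhG; case: n fh m3 fhG => [|[|[|[|//]]]] fh _ fhG.
- by have := level_eq0 fh => e; have := notinC hS hH; rewrite e (attC au).
- by have [_ uh'] := f1 _ fh fhG; rewrite uh' in uh.
- have [_ [h1 f1' h1h]] := pred1 _ _ fh fhG.
  have [h1H uh1] := f1 _ f1' (ltnW fhG).
  exact: (Z4_linked2 au aw h1H hH uh1 h1h wh uh (dis _ h1H uh1) nuw uw).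
have G2 := ltnW fhG; have G1 := ltnW G2; have G0 := ltnW G1.
have [_ [h2 f2 h23]] := pred1 _ _ fh fhG.
have [h2H [h1 f1' h12]] := pred1 _ _ f2 G2.
have [h1H uh1] := f1 _ f1' G1.
apply: (Z3 h1 h2 h w) => //.
- by rewrite adjC.
- exact: far fu f2 _ _ _.
- exact: far f1' fh _ _ _.
- by rewrite adjC; exact: dis.
- rewrite adjC; apply/negP=> wh2; have := hmin h2; rewrite h2H wh2 f2 fh.
  by move=> /(_ isT).
Qed.

End Z4.

Section Z4Rooted.
Variables (Hs : seq sgraph) (G : sgraph) (C : seq G) (H : {set G}).
Hypothesis hfree : free Hs G.
Hypothesis inC : List.In claw Hs.
Hypothesis inZ : List.In (graph_Z 4) Hs.
Hypothesis hS : outer_component C H.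
Implicit Types (x y z g q e : G) (A B s : seq G).

Local Notation att := (attached C H).
Local Notation natt := (unattached C H).

Let claw u x y z : adj u x -> adj u y -> adj u z -> x != y -> x != z ->
  y != z -> ~~ adj x y -> ~~ adj x z -> adj y z.
Proof.
move=> ux uy uz xy xz yz nxy nxz; apply/negPn/negP=> nyz.
exact: (claw_free hfree inC ux uy uz xy xz yz nxy nxz nyz).
Qed.

Let neq_att x y : att x -> natt y -> x != y.
Proof. by move=> ax ny; apply: contraTneq ny => <-; rewrite /unattached ax andbF. Qed.

Let disjoint x y z : att x -> att y -> x != y -> natt z -> adj x z -> ~~ adj y z.
Proof. exact: (natt_disjoint hfree inC hS). Qed.

Variables (u h h' : G).
Hypotheses (au : att u) (hH : h \in H) (h'H : h' \in H).
Hypotheses (uh : adj u h) (uh' : adj u h') (hh' : adj h h').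
Hypothesis meet : forall w, att w -> w != u ->
  exists g, [/\ g \in H, adj u g & adj w g].

Lemma no_path4 x1 x2 x3 x4 : natt x1 -> natt x2 -> natt x3 -> natt x4 ->
  adj u x1 -> adj x1 x2 -> adj x2 x3 -> adj x3 x4 ->
  ~~ adj u x2 -> ~~ adj u x3 -> ~~ adj u x4 ->
  ~~ adj x1 x3 -> ~~ adj x1 x4 -> ~~ adj x2 x4 -> False.
Proof.
move=> *; apply: (Z4_free hfree (a := u) (b := h) (c := h')
    (p1 := x1) (p2 := x2) (p3 := x3) (p4 := x4) inZ); adj_auto.
Qed.

Lemma no_adjacent_nbrs w z b : att w -> w != u -> natt z -> adj w z -> natt b ->
  adj u b -> ~~ adj b z.
Proof.
move=> aw wu nz wz nb ub; apply/negP=> bz; have uw : u != w by rewrite eq_sym.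
have uz : ~~ adj u z by exact: disjoint aw au wu nz wz.
have wb : ~~ adj w b by exact: disjoint au aw uw nb ub.
suff main A B c d a : ~ arr C u A w B b c d a.
  have [A [B [b' [c [d [a ha]]]]]] := arr_exists hS au aw uw.
  have [A' [B' [d' [x [ha'|ha']]]]] := arr_move hfree inC hS au aw ha nb ub.
    exact: main ha'.
  exact: main (arr_rev ha').
move=> ha0; have [A' [B' [c' [d1 [d2 [ha wB dd wd2]]]]]] :=
  arr_settle hfree inC hS au aw ha0.
have [nd2 ud2 bd2] := settled_far hfree inC hS au aw ha wB dd wd2.
have [_ _ nd1 _] := arr_natts hS au aw ha.
have [_ _ ud1 _] := arr_ends hfree inC hS au aw ha.
have bd1 := arr_bd hS au aw ha.
have wd1 : adj w d1 by case: ha => _ _ [].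
have zd1 : adj z d1.
  apply: (natt_clique hfree inC hS aw nz nd1 wz wd1).
  by apply: contraNneq bd1 => <-.
apply: (@no_path4 b z d1 d2) => //; apply/negP=> zd2; case/negP: bd2.
have zw : adj z w by rewrite adjC.
have zb : adj z b by rewrite adjC.
apply: (claw zw zb zd2) => //; try exact: neq_att.
by apply: contraNneq ud2 => <-.
Qed.

Let X x : bool := (x == u) || natt x.
Local Notation f := (level X u).

Let cG : 2 < #|G|.
Proof.
by apply: leq_trans (sizeC hS) _; rewrite -(card_uniqP (uniqC hS)) max_card.
Qed.

Let fuG : f u < #|G|.
Proof. by rewrite level_root; exact: ltnW (ltnW cG). Qed.

Let pred1 x n : f x = n.+1 -> n.+1 < #|G| ->
  natt x /\ exists2 y, f y = n & adj y x.
Proof.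
move=> e lt; have [Xx ?] := level_pred e lt; split=> //.
move: Xx; rewrite /X => /orP[/eqP xu|//].
by rewrite xu level_root in e.
Qed.

Let f1 x : f x = 1 -> natt x /\ adj u x.
Proof.
move=> e; have [nx [y fy yx]] := pred1 e (ltnW cG).
by rewrite -(level_eq0 fy).
Qed.

Let Xn x : natt x -> X x.
Proof. by rewrite /X => ->; rewrite orbT. Qed.

Let far x y n m : f x = n -> f y = m -> n.+1 < m -> m < #|G| -> ~~ adj x y.
Proof.
move=> fx fy nm mG; apply: (@level_far _ X u); rewrite ?fx ?fy //.
  by case: m fy nm mG => // m fy _ mG; have [ny _] := pred1 fy mG; exact: Xn.
exact: ltn_trans (ltnW nm) mG.
Qed.

Let step x y : f x < #|G| -> natt y -> adj x y -> f y <= (f x).+1 /\ f y < #|G|.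
Proof. by move=> fx ny xy; exact: level_step xy (Xn ny) fx. Qed.

Let fle3 x : f x < #|G| -> f x <= 3.
Proof.
move=> fG; rewrite leqNgt; apply/negP=> f4.
have [x4 fx4] := level_between (erefl (f x)) fG f4.
have G4 : 4 < #|G| by exact: leq_ltn_trans f4 fG.
have G3 := ltnW G4; have G2 := ltnW G3.
have [n4 [x3 fx3 x34]] := pred1 fx4 G4.
have [n3 [x2 fx2 x23]] := pred1 fx3 G3.
have [n2 [x1 fx1 x12]] := pred1 fx2 G2.
have [n1 ux1] := f1 fx1; have fu := level_root X u.
apply: (@no_path4 x1 x2 x3 x4) => //.
- exact: far fu fx2 _ _.
- exact: far fu fx3 _ _.
- exact: far fu fx4 _ _.
- exact: far fx1 fx3 _ _.
- exact: far fx1 fx4 _ _.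
- exact: far fx2 fx4 _ _.
Qed.

Let far_att w z : att w -> w != u -> natt z -> adj w z -> f z < #|G| -> f z = 3.
Proof.
move=> aw wu nz wz fG; have := fle3 fG; rewrite leq_eqVlt => /orP[/eqP //|].
have [n fz] : exists n, f z = n by exists (f z).
rewrite fz in fG *; case: n fz fG => [|[|[|//]]] fz fG _.
- by move: nz; rewrite (level_eq0 fz) /unattached au andbF.
- have [_ uz] := f1 fz; have uw : u != w by rewrite eq_sym.
  by have := disjoint au aw uw nz uz; rewrite wz.
- have [_ [b fb bz]] := pred1 fz fG; have [nb ub] := f1 fb.
  by have := no_adjacent_nbrs aw wu nz wz nb ub; rewrite bz.
Qed.

Section Third.
Variables (w c : G) (A B : seq G) (b d a : G).
Hypotheses (ha : arr C u A w B b c d a) (aw : att w).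
Hypothesis nA : forall x, x \in A -> natt x.

Let wu : w != u. Proof. by rewrite eq_sym (arr_neq hS ha). Qed.

Let fbG : f b = 1.
Proof.
have [nb _ _ _] := arr_natts hS au aw ha; case: ha => _ _ [ub _ _ _] _.
have [le _] := step fuG nb ub; rewrite level_root in le.
apply/eqP; rewrite eqn_leq le; apply: level_gt0.
by rewrite eq_sym; exact: neq_att.
Qed.

Let faG : f a = 1.
Proof.
have [_ _ _ na] := arr_natts hS au aw ha; case: ha => _ _ [_ _ _ au'] _.
have [|le _] := @step u a fuG na; first by rewrite adjC.
rewrite level_root in le.
apply/eqP; rewrite eqn_leq le; apply: level_gt0.
by rewrite eq_sym; exact: neq_att.
Qed.

Let fc : f c = 3 /\ 3 < #|G|.
Proof.
have [nb nc _ _] := arr_natts hS au aw ha; case: ha => wA _ [ub cw _ _] _.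
have fcG : f c < #|G|.
  apply: (level_walk wA); last by rewrite fbG; exact: ltnW cG.
  by apply/allP=> x /nA; exact: Xn.
have f3 : f c = 3 by apply: (far_att aw wu nc _ fcG); rewrite adjC.
by split=> //; rewrite -f3.
Qed.

Let f3 : f c = 3. Proof. by case: fc. Qed.
Let G3 : 3 < #|G|. Proof. by case: fc. Qed.

Let K x : bool := (x == c) || adj c x && ((f x == 2) || (f x == 3)).

Let parent q : f q = 2 -> natt q /\ exists2 b1, natt b1 & [/\ f b1 = 1, adj u b1 & adj b1 q].
Proof.
move=> fq; have [nq [b1 fb1 b1q]] := pred1 fq cG.
by have [nb1 ub1] := f1 fb1; split=> //; exists b1.
Qed.

Let natt3 y : f y = 3 -> natt y.
Proof. by move=> fy; have [] := pred1 fy G3. Qed.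

(* Otherwise [u], a parent of [q], [q], [y], [x] would be an induced path. *)
Let chain3 q y x : f q = 2 -> f y = 3 -> adj q y -> adj y x -> natt x ->
  ~~ adj u x -> (forall b1, f b1 = 1 -> adj b1 q -> ~~ adj b1 x) -> adj q x.
Proof.
move=> fq fy qy yx nx ux nb; have [nq [b1 nb1 [fb1 ub1 b1q]]] := parent fq.
apply/negPn/negP=> qx; have fu := level_root X u.
apply: (@no_path4 b1 q y x) => //.
- exact: natt3.
- exact: far fu fq _ _.
- exact: far fu fy _ _.
- exact: far fb1 fy _ _.
- exact: nb.
Qed.

Let up q y x : f q = 2 -> f y = 3 -> adj q y -> adj y x -> f x = 3 -> adj q x.
Proof.
move=> fq fy qy yx fx; have nx := natt3 fx; have fu := level_root X u.
apply: (chain3 fq fy qy yx nx); first exact: far fu fx _ _.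
by move=> b1 fb1 _; exact: far fb1 fx _ _.
Qed.

Let children q x y : f q = 2 -> adj q x -> adj q y -> f x = 3 -> f y = 3 ->
  x != y -> adj x y.
Proof.
move=> fq qx qy fx fy xy; have [_ [b1 _ [fb1 _ b1q]]] := parent fq.
have qb : adj q b1 by rewrite adjC.
apply: (claw qb qx qy) => //.
- by apply/eqP=> e; move: fb1; rewrite e fx.
- by apply/eqP=> e; move: fb1; rewrite e fy.
- exact: far fb1 fx _ _.
- exact: far fb1 fy _ _.
Qed.

Let q0P : exists q0, f q0 = 2 /\ adj q0 c.
Proof. by have [_ [q0 fq qc]] := pred1 f3 G3; exists q0. Qed.

Let K_level x : K x -> f x = 2 \/ f x = 3.
Proof.
by case/orP=> [/eqP->|/andP[_ /orP[] /eqP->]]; [right; exact: f3|left|right].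
Qed.

Let K_natt x : K x -> natt x.
Proof. by case/K_level=> fx; [have [] := parent fx | exact: natt3]. Qed.

Let K_c x : K x -> x != c -> adj c x.
Proof. by rewrite /K; case: eqVneq => //= _ /andP[]. Qed.

Let K2 q : f q = 2 -> K q = adj q c.
Proof.
move=> fq; rewrite /K fq eqxx orTb andbT adjC.
by case: eqVneq => // e; move: fq; rewrite e f3.
Qed.

Let K3 q x : f q = 2 -> adj q c -> f x = 3 -> K x = adj q x.
Proof.
move=> fq qc fx; rewrite /K fx eqxx orbT andbT; have [->//|xc] := eqVneq x c.
apply/idP/idP=> [cx|qx]; first exact: up fq f3 qc cx fx.
by apply: (children fq qc qx f3 fx); rewrite eq_sym.
Qed.

Let K_closed y x : K y -> f y = 3 -> adj y x -> natt x -> K x.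
Proof.
move=> Ky fy yx nx; have [q [fq qc]] := q0P.
have yG : f y < #|G| by rewrite fy.
have [_ xG] := step yG nx yx.
have qy : adj q y by rewrite -(K3 fq qc fy).
have [n fx] : exists n, f x = n by exists (f x).
have := fle3 xG; rewrite leq_eqVlt => /orP[/eqP fx3|].
  by rewrite (K3 fq qc fx3); exact: up fq fy qy yx fx3.
have xy : adj x y by rewrite adjC.
rewrite leq_eqVlt => /orP[/eqP [fx2]|].
  rewrite K2 //; have [<-//|yc] := eqVneq y c.
  have cy : adj c y by exact: K_c.
  by apply: (up fx2 fy xy _ f3); rewrite adjC.
by move=> fx1; have := far (erefl (f x)) fy fx1 G3; rewrite xy.
Qed.

Let K_clique x y : K x -> K y -> x != y -> adj x y.
Proof.
move=> Kx Ky xy; have [q [fq qc]] := q0P.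
have [_ nc _ _] := arr_natts hS au aw ha.
have cw : adj c w by case: ha => _ _ [].
have low z : f z = 2 -> natt z -> ~~ adj w z.
  move=> fz nz; apply/negP=> wz.
  by have := far_att aw wu nz wz; rewrite fz => /(_ cG).
case: (K_level Kx) (K_level Ky) => fx [] fy.
- have [nx ny] := (K_natt Kx, K_natt Ky).
  move: Kx Ky; rewrite !K2 // => xc yc.
  have cx : adj c x by rewrite adjC.
  have cy : adj c y by rewrite adjC.
  apply: (claw cw cx cy) => //; try exact: neq_att; exact: low.
- by rewrite -(K3 fx _ fy) // -K2.
- by rewrite adjC -(K3 fy _ fx) // -K2.
- move: Kx Ky; rewrite !(K3 fq qc) // => qx qy.
  exact: children fq qx qy fx fy xy.
Qed.

Let K_exit q e : K q -> adj q e -> natt e -> ~~ K e ->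
  f q = 2 /\ (f e = 1 \/ f e = 2).
Proof.
move=> Kq qe ne nKe; have fq : f q = 2.
  by case: (K_level Kq) => // fq; case/negP: nKe; exact: K_closed Kq fq qe ne.
split=> //; have qG : f q < #|G| by rewrite fq.
have [_ eG] := step qG ne qe.
have qc : adj q c by rewrite -K2.
have := fle3 eG; have [n fe] : exists n, f e = n by exists (f e).
rewrite fe; case: n fe => [|[|[|[|//]]]] fe _; [|by left|by right|].
- by move: ne; rewrite (level_eq0 fe) /unattached au andbF.
- by move: nKe; rewrite (K3 fq qc fe) qe.
Qed.

Lemma third_level_false : False.
Proof.
have [nb nc nd na] := arr_natts hS au aw ha.
have cd := arr_cd hfree inC hS au aw ha.
have uw : u != w by rewrite eq_sym; exact: wu.
have p : perm_eq (u :: A ++ w :: B) C by case: ha.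
have un := arr_uniq hS ha.
have [wA wB [ub cw wd au'] _] := ha.
have Kc : K c by rewrite /K eqxx.
have dG : f d < #|G| by apply: (proj2 (step _ nd cd)); rewrite f3.
have fd : f d = 3 by exact: far_att aw wu nd wd dG.
have Kd : K d by rewrite /K cd fd orbT.
have nK1 x : f x = 1 -> ~~ K x.
  by move=> fx; apply/negP=> /K_level[]; rewrite fx.
have [s1 [s2 [q [e [eA w1 qe w2 [Ks1 Kq nKe]]]]]] :=
  walk_cross (P := K) (walk_rev wA) Kc (nK1 _ fbG).
have ne : natt e by apply: nA; rewrite -mem_rev eA mem_cat (walk_mem_head w2) orbT.
have [fq fe] := K_exit Kq qe ne nKe.
have Pd : K d || att d by rewrite Kd.
have nPa : ~~ (K a || att a).
  by rewrite negb_or nK1 ?faG //; case/andP: na.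
have [t1 [t2 [q' [e' [eB w3 qe' w4 [Pt1 Pq' nPe']]]]]] :=
  walk_cross (P := fun x => K x || att x) wB Pd nPa.
have inBC x : x \in B -> x \in C.
  by move=> xB; rewrite -(perm_mem p) inE mem_cat inE xB !orbT.
have [nKe' ne'] : ~~ K e' /\ natt e'.
  move: nPe'; rewrite negb_or => /andP[-> nat]; split=> //.
  by rewrite /unattached nat inBC // eB mem_cat (walk_mem_head w4) orbT.
have Kq' : K q'.
  case/orP: Pq' => // aq'.
  have q'u : q' != u.
    move: un => /= /andP[+ _]; apply: contraNneq => <-.
    by rewrite mem_cat inE eB mem_cat (walk_mem_last w3) !orbT.
  case/lastP: t1 w3 Pt1 eB => // t1 z w3 Pt1 eB.
  have [ez [[_ ed]|[x xq' w5]]] := walk_rconsI w3.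
    by case/andP: nd => _ /negP[]; rewrite -ed.
  rewrite {z}ez in w3 Pt1 eB.
  have nx : natt x.
    apply: (att_consecutive hS (s := rev (t2 ++ u :: A ++ w :: t1)) (a := e') aq').
    - by rewrite eB in p; perm_tac p.
    - apply: walk_rev.
      exact: walk_cat w4 au' (walk_cons ub (walk_cat wA cw (walk_cons wd w5))).
    - by rewrite adjC.
    - by rewrite adjC.
  have Kx : K x.
    have : K x || att x.
      by apply: (allP Pt1); rewrite mem_rcons inE (walk_mem_last w5) orbT.
    by case/andP: nx => _ /negbTE->; rewrite orbF.
  have q'x : adj q' x by rewrite adjC.
  have xe' : x != e' by apply: contraNneq nKe' => <-.
  have fx : f x = 3.
    apply: (far_att aq' q'u nx q'x).
    by case: (K_level Kx) => ->; [exact: cG | exact: G3].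
  case/negP: nKe'; apply: (K_closed Kx fx _ ne').
  exact: (natt_clique hfree inC hS aq' nx ne' q'x qe' xe').
have [fq' fe'] := K_exit Kq' qe' ne' nKe'.
have eA' : A = rev s2 ++ rev s1 by rewrite -rev_cat -eA revK.
have e'B : e' \in B by rewrite eB mem_cat (walk_mem_head w4) orbT.
have q'B : q' \in B by rewrite eB mem_cat (walk_mem_last w3).
have eAm : e \in A by rewrite eA' mem_cat mem_rev (walk_mem_head w2).
have qAm : q \in A by rewrite eA' mem_cat !mem_rev (walk_mem_last w1) orbT.
have dis x y : x \in A -> y \in B -> x != y.
  move: un; rewrite -cat_cons cat_uniq => /and3P[_ /hasPn ds _] xA yB.
  have := ds y; rewrite !inE yB orbT => /(_ isT); rewrite negb_or => /andP[_].
  by apply: contraNneq => <-.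
have eq : adj e q by rewrite adjC.
have e'q' : adj e' q' by rewrite adjC.
have adn x y : f x = 1 -> f y = 1 -> x != y -> adj x y.
  move=> /f1[nx ux] /f1[ny uy]; exact: (natt_clique hfree inC hS au nx ny ux uy).
have ua : adj u a by rewrite adjC.
have cq' : adj c q' by apply: K_clique => //; apply: dis => //; exact: walk_mem_last wA.
have [fe'1|fe'2] := fe'.
  have e'b : adj e' b.
    by apply: adn => //; rewrite eq_sym; apply: dis => //; exact: walk_mem_head wA.
  apply: (reroute_all hS au aw uw (q := u :: rev t2 ++ A ++ rev t1 ++ [:: w])).
    apply: walk_cons ua (walk_cat (walk_rev w4) e'b (walk_cat wA cq'
      (walk_cat (walk_rev w3) _ (walk1 w)))); by rewrite adjC.
  by rewrite eB in p; perm_tac p.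
have dq : adj d q.
  by apply: K_clique => //; rewrite eq_sym; apply: dis => //; exact: walk_mem_head wB.
have [fe1|fe2] := fe.
  have ea : adj e a.
    by apply: adn => //; apply: dis => //; exact: walk_mem_last wB.
  apply: (reroute_all hS au aw uw (q := u :: rev s2 ++ rev B ++ rev s1 ++ [:: w])).
    exact: walk_cons ub (walk_cat (walk_rev w2) ea (walk_cat (walk_rev wB) dq
      (walk_cat (walk_rev w1) cw (walk1 w)))).
  by rewrite eA' in p; perm_tac p.
have low z : f z = 2 -> natt z -> ~~ adj w z.
  move=> fz nz; apply/negP=> wz.
  by have := far_att aw wu nz wz; rewrite fz => /(_ cG).
have nq := K_natt Kq; have wc : adj w c by rewrite adjC.
have qc : adj q c by rewrite -K2.
have cq : adj c q by rewrite adjC.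
have fu := level_root X u.
have [/existsP[g1 /existsP[g2]]|nog] :=
  boolP [exists g1, exists g2, [&& g1 \in H, g2 \in H, adj w g1, adj w g2 & g1 != g2]].
  case/and5P=> g1H g2H wg1 wg2 g12.
  have g12' := att_clique hfree inC hS aw g1H g2H wg1 wg2 g12.
  have [_ [b1 nb1 [fb1 ub1 b1q]]] := parent fq.
  have qa : adj q a.
    apply/negPn/negP=> qa.
    have b1a : adj b1 a by apply: adn => //; apply: contraNneq qa => <-; rewrite adjC.
    have cb1 : ~~ adj c b1 by rewrite adjC; exact: far fb1 f3 _ _.
    have ca : ~~ adj c a by rewrite adjC; exact: far faG f3 _ _.
    have wb1 := disjoint au aw uw nb1 ub1; have wa := disjoint au aw uw na ua.
    have wq := low _ fq nq.
    apply: (Z4_free hfree (a := w) (b := g1) (c := g2)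
      (p1 := c) (p2 := q) (p3 := b1) (p4 := a) inZ); adj_auto.
  have es1 : rev s1 = q :: behead (rev s1).
    by have /walkE[s ->] := walk_rev w1.
  set S := behead (rev s1) in es1.
  have wS : exists2 x, walk x S c & K x.
    have := walk_rev w1; rewrite es1 => /walk_consI[_ [[_ eqc]|[x qx wx]]].
      by move: fq; rewrite -eqc f3.
    exists x => //; apply: (allP Ks1); rewrite -mem_rev es1 inE.
    by rewrite (walk_mem_head wx) orbT.
  have [x wx Kx] := wS.
  have dx : adj d x.
    apply: K_clique => //; rewrite eq_sym; apply: dis; last exact: walk_mem_head wB.
    by rewrite eA' mem_cat es1 inE (walk_mem_head wx) !orbT.
  apply: (reroute_all hS au aw uw
    (q := u :: rev s2 ++ q :: rev t2 ++ rev t1 ++ S ++ [:: w])).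
    exact: walk_cons ub (walk_cat (walk_rev w2) eq (walk_cons qa (walk_cat
      (walk_rev w4) e'q' (walk_cat (walk_rev w3) dx (walk_cat wx cw (walk1 w)))))).
  by rewrite eA' es1 eB in p; perm_tac p.
have one g1 g2 : g1 \in H -> g2 \in H -> adj w g1 -> adj w g2 -> g1 = g2.
  move=> g1H g2H wg1 wg2; apply/eqP; apply: contraNT nog => g12.
  by apply/existsP; exists g1; apply/existsP; exists g2; apply/and5P.
have [g [gH ug wg]] := meet aw wu.
have [k [kH uk kg]] : exists k, [/\ k \in H, adj u k & k != g].
  have [hg|hg] := eqVneq h g; last by exists h.
  by exists h'; rewrite -hg eq_sym (adj_neq hh').
have gk : adj g k by apply: (att_clique hfree inC hS au gH kH ug uk); rewrite eq_sym.
have wk : ~~ adj w k by apply: contraNN kg => wk; rewrite (one k g).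
have nuw : ~~ adj u w.
  apply/negP=> nuw; case/negP: wk.
  exact: (adj_att_nbrs hfree inC hS au aw nuw kH uk).
have uc : ~~ adj u c by exact: far fu f3 _ _.
have uq : ~~ adj u q by exact: far fu fq _ _.
have ue : ~~ adj u e by exact: far fu fe2 _ _.
have wq := low _ fq nq; have we := low _ fe2 ne.
have ce : ~~ adj c e by move: nKe; rewrite K2 // adjC.
apply: (Z4_free hfree (a := g) (b := u) (c := k)
  (p1 := w) (p2 := c) (p3 := q) (p4 := e) inZ); adj_auto.
Qed.

End Third.

Lemma Z4_rooted_false : False.
Proof.
have [A [w [B [b [c [d [a [ha aw nA]]]]]]]] := arr_first hS au.
exact: third_level_false ha aw nA.
Qed.

End Z4Rooted.

Section Z4.
Variables (Hs : seq sgraph) (G : sgraph) (C : seq G) (H : {set G}).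
Hypothesis hfree : free Hs G.
Hypothesis inC : List.In claw Hs.
Hypothesis inZ : List.In (graph_Z 4) Hs.
Hypothesis hS : outer_component C H.

Lemma Z4_free_false : False.
Proof.
have [_ _ _ [g0 [_ [g0H _ _]]] an] := hS.
have meet (u w : G) : attached C H u -> attached C H w -> w != u ->
    exists g, [/\ g \in H, adj u g & adj w g].
  move=> au aw wu.
  have [/existsP[g /and3P[*]]|no] :=
    boolP [exists g, [&& g \in H, adj u g & adj w g]]; first by exists g.
  case: (Z4_disjoint hfree inC inZ hS au aw); first by rewrite eq_sym.
  move=> h hH uh; apply: contraNN no => wh.
  by apply/existsP; exists h; rewrite hH uh.
have root u h h' : attached C H u -> h \in H -> h' \in H -> adj u h -> adj u h' ->
    h != h' -> False.
  move=> au hH h'H uh uh' hh'.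
  apply: (Z4_rooted_false hfree inC inZ hS au hH h'H uh uh').
    exact: (att_clique hfree inC hS au hH h'H uh uh' hh').
  by move=> w aw wu; exact: meet.
have [u [h [uC hH uh _ _]]] := an g0.
have [w [h' [wC h'H wh' _ h'h]]] := an h.
have au := att_intro uC hH uh; have aw := att_intro wC h'H wh'.
have [e|wu] := eqVneq w u.
  by rewrite e in wh'; exact: root au h'H hH wh' uh h'h.
have [g [gH ug wg]] := meet u w au aw wu.
have [e|gh] := eqVneq g h; last exact: root au gH hH ug uh gh.
by rewrite e in wg; exact: root aw h'H hH wh' wg h'h.
Qed.

End Z4.

Theorem theorem2 (Hs : seq sgraph) (hHs : List.In Hs forbidden_pairs)
  (G : sgraph) (hconn : k_connected 2 G) (hfree : free Hs G) :
  has_dominating_cycle G.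
Proof.
have [//|[C [H hS]]] := dominating_or_outer_component hconn.
exfalso; move: hHs hfree => /= [<-|[<-|[<-|[<-|[<-|//]]]]] hfree.
- by apply: (Z4_free_false hfree _ _ hS) => /=; auto.
- by apply: (B12_free_false hfree _ hS) => /=; auto.
- by apply: (net_free_false hfree _ hS) => /=; auto.
- by apply: (P4W_false hfree _ _ hS) => /=; auto.
have inZ : List.In (graph_Z 1) [:: claw_star_star; graph_Z 1] by right; left.
have inS : List.In claw_star_star [:: claw_star_star; graph_Z 1] by left.
apply: (triangle_free_false hfree inS hS) => x y z xy xz yz.
exact: (paw_triangle_false hfree inZ hconn hS xy xz yz).
Qed.
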